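(* Let $\Omega\subset\mathbb{R}^n$ be a bounded domain, $2\le n<p<\infty$, and let $u_p$ be a viscosity solution of $$-\Delta_p^N u_p(x)=f_p(x)\ \text{ in }\Omega,\qquad u_p(x)=g_p(x)\ \text{ on }\partial\Omega,$$ with $f_p\in\mathcal{C}(\Omega)$ and $g_p\in\mathcal{C}^{0,\frac{p-n}{p-1}}(\partial\Omega)$. Suppose that, as $p\to\infty$, $f_p$ and $g_p$ converge uniformly to some $f\in\mathcal{C}(\Omega)$ and some $g$ (which in turn is $\mathcal{C}^{0,1}(\partial\Omega)$), respectively. Then there exists a subsequence $u_{p'}$ that converges uniformly to some $u$, a viscosity solution of $$-\Delta_\infty^N u(x)=f(x)\ \text{ in }\Omega,\qquad u(x)=g(x)\ \text{ on }\partial\Omega .$$ Moreover, $u\in\mathcal{C}^{0,1}(\Omega)$.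
   Context: For a symmetric matrix $X$, $M(X)$ and $m(X)$ denote its greatest and smallest eigenvalues. Where $\nabla\varphi\ne0$: $\Delta_\infty^N\varphi=\big\langle D^2\varphi\frac{\nabla\varphi}{|\nabla\varphi|},\frac{\nabla\varphi}{|\nabla\varphi|}\big\rangle$ and, for $p<\infty$, $\Delta_p^N\varphi=\frac1p|\nabla\varphi|^{2-p}{\rm div}(|\nabla\varphi|^{p-2}\nabla\varphi)=\frac1p\Delta\varphi+\frac{p-2}{p}\Delta_\infty^N\varphi$. Viscosity solutions (for $2<p\le\infty$): an upper semicontinuous $u:\Omega\to\mathbb{R}$ is a viscosity subsolution of $-\Delta_p^N u=f$ in $\Omega$ if for all $x_0\in\Omega$ and $\varphi\in\mathcal{C}^2(\Omega)$ such that $u-\varphi$ has a local maximum at $x_0$, one has $-\Delta_p^N\varphi(x_0)\le f(x_0)$ if $\nabla\varphi(x_0)\ne0$, while if $\nabla\varphi(x_0)=0$ one has $-\frac1p\Delta\varphi(x_0)-\frac{p-2}pM(D^2\varphi(x_0))\le f(x_0)$ when $p<\infty$, and $-M(D^2\varphi(x_0))\le f(x_0)$ when $p=\infty$. A lower semicontinuous $u:\Omega\to\mathbb{R}$ is a viscosity supersolution if for all $x_0\in\Omega$ and $\varphi\in\mathcal{C}^2(\Omega)$ such that $u-\varphi$ has a local minimum at $x_0$, one has $-\Delta_p^N\varphi(x_0)\ge f(x_0)$ if $\nabla\varphi(x_0)\ne0$, while if $\nabla\varphi(x_0)=0$ one has $-\frac1p\Delta\varphi(x_0)-\frac{p-2}pm(D^2\varphi(x_0))\ge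 f(x_0)$ when $p<\infty$, and $-m(D^2\varphi(x_0))\ge f(x_0)$ when $p=\infty$. A viscosity solution is both a viscosity subsolution and a viscosity supersolution. $\mathcal{C}^{0,\gamma}$ is the space of functions $w$ with finite norm $\|w\|_{L^\infty}+\sup_{x\ne y}\frac{|w(x)-w(y)|}{|x-y|^\gamma}$.
   Formalization: The limit f is additionally assumed bounded on Ω; for f merely continuous on Ω the Lipschitz claim fails (unit ball, g_p=0, f_p=f radial, equal to (1-|x|)^{-3/2} near the boundary, where u behaves like 4(1-|x|)^{1/2}). *)

(* Defs.v *)
From HB Require Import structures.
From mathcomp Require Import all_boot all_order all_algebra.
From mathcomp Require Import all_classical all_reals all_analysis.
From mathcomp Require Import ring.

Set Implicit Arguments.
Unset Strict Implicit.
Unset Printing Implicit Defensive.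

Import Order.TTheory GRing.Theory Num.Theory.
Import numFieldNormedType.Exports.

Local Open Scope classical_set_scope.
Local Open Scope ring_scope.

Section Defs.
Context {R : realType} {n : nat}.
Implicit Types (Omega A : set 'rV[R]_n) (x y v w : 'rV[R]_n).
Implicit Types (u f g phi : 'rV[R]_n -> R) (p : \bar R).

(* The library norm `|x| on 'rV[R]_n is the sup norm; |x| in R^n is Euclidean. *)
Definition dot v w : R := \sum_i v 0 i * w 0 i.

Definition enorm v : R := Num.sqrt (dot v v).

Definition bounded_domain Omega : Prop :=
  [/\ open Omega, connected Omega, Omega !=set0 & bounded_set Omega].

Definition boundary A : set 'rV[R]_n := closure A `\` interior A.

(* The sums below never have the form -oo + +oo: the first supremum is -oo only
   when A is empty, and then so is the second. *)
Definition holder_norm A (gamma : R) g : \bar R :=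
  (ereal_sup [set `|g x|%:E | x in A]
   + ereal_sup [set (`|g z.1 - g z.2| / enorm (z.1 - z.2) `^ gamma)%:E
               | z in [set z | [/\ A z.1, A z.2 & z.1 != z.2]]])%E.

Definition holder A (gamma : R) g : Prop := (holder_norm A gamma g < +oo)%E.

Definition partial (i : 'I_n) phi : 'rV[R]_n -> R :=
  fun x => 'D_(delta_mx 0 i) phi x.

Definition grad phi x : 'rV[R]_n := \row_i partial i phi x.

Definition hess phi x : 'M[R]_n := \matrix_(i, j) partial j (partial i phi) x.

Definition divergence (F : 'rV[R]_n -> 'rV[R]_n) x : R :=
  \sum_i partial i (fun y => F y 0 i) x.

Definition laplacian phi x : R := \tr (hess phi x).

(* phi and its partial derivatives up to order two exist and are continuous on
   the open set Omega. *)
Definition C2 Omega phi : Prop := forall x, Omega x ->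
  [/\ {for x, continuous phi},
      forall i, derivable phi x (delta_mx 0 i)
                /\ {for x, continuous (partial i phi)}
    & forall i j, derivable (partial i phi) x (delta_mx 0 j)
                  /\ {for x, continuous (partial j (partial i phi))}].

(* Meaningful for symmetric X and 0 < n: the spectrum is then finite and
   nonempty, and the sup and the inf are attained. *)
Definition max_eigenvalue (X : 'M[R]_n) : R := sup [set a | eigenvalue X a].

Definition min_eigenvalue (X : 'M[R]_n) : R := inf [set a | eigenvalue X a].

Definition norm_inf_laplacian phi x : R :=
  let e := (enorm (grad phi x))^-1 *: grad phi x in dot (e *m hess phi x) e.

(* Delta phi (x) / p + (p - 2) / p * l for finite p, and its limit l for p = +oo;
   l stands for the normalized infinity Laplacian, or for the extremal
   eigenvalue of the Hessian replacing it at critical points. The exponent -oo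
   is never used. *)
Definition plap_combination p phi x (l : R) : R :=
  if p is q%:E then q^-1 * laplacian phi x + (q - 2) / q * l else l.

Definition norm_p_laplacian p phi x : R :=
  plap_combination p phi x (norm_inf_laplacian phi x).

Lemma is_derive_comp_real (h : R -> R) (F : 'rV[R]_n -> R) x v (a b : R) :
  is_derive (F x) 1 h a -> is_derive x v F b ->
  is_derive x v (fun y => h (F y)) (a * b).
Proof.
move=> ha [dF Fb]; have dF1 := (derivable1P F x v).1 dF.
have line (G : 'rV[R]_n -> R) :
    'D_v G x = 'D_1 (fun t : R => G (t *: v + x)) 0.
  rewrite /derive; set g1 := fun h => h^-1 *: _; set g2 := fun h => h^-1 *: _.
  suff -> : g1 = g2 by [].
  by apply/funext => t; rewrite /g1 /g2 /= addr0 scale0r add0r [t%:A]mulr1.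
have F1 : is_derive (0 : R) 1 (fun t : R => F (t *: v + x)) b.
  by split; [exact: dF1|rewrite -line].
have ha' : is_derive (F (0 *: v + x)) 1 h a by rewrite scale0r add0r.
have [H1 H2] := is_derive1_comp ha' F1.
by split; [exact: (derivable1P _ _ _).2|rewrite line].
Qed.

(* For finite p the normalized p-Laplacian is |grad phi|^(2-p) / p times the
   p-Laplacian in divergence form. *)
Lemma norm_p_laplacian_divergence (q : R) phi x :
  q != 0 -> grad phi x != 0 ->
  (forall i j, derivable (partial i phi) x (delta_mx 0 j)) ->
  norm_p_laplacian q%:E phi x =
  q^-1 * enorm (grad phi x) `^ (2 - q) *
    divergence (fun y => enorm (grad phi y) `^ (q - 2) *: grad phi y) x.
Proof.
move=> q0 g0 dphi.
pose S y := dot (grad phi y) (grad phi y).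
have S_ge0 y : 0 <= S y by apply: sumr_ge0 => i _; rewrite -expr2 sqr_ge0.
have Sx0 : 0 < S x.
  rewrite lt_def S_ge0 andbT; apply: contra g0 => /eqP.
  move=> /psumr_eq0P H; apply/eqP/rowP => i; rewrite [RHS]mxE.
  have /eqP : grad phi x 0 i * grad phi x 0 i = 0.
    by apply: H => // j _; rewrite -expr2 sqr_ge0.
  by rewrite mulf_eq0 orbb => /eqP.
set N := enorm (grad phi x).
have N2 : N ^+ 2 = S x by rewrite /N /enorm sqr_sqrtr // S_ge0.
have N0 : 0 < N by rewrite /N /enorm sqrtr_gt0.
have dS i : is_derive x (delta_mx 0 i) S
    (\sum_k (2 * grad phi x 0 k * hess phi x k i)).
  have -> : S = \sum_k (partial k phi * partial k phi).
    apply/funext => y; rewrite /S /dot fct_sumE; apply: eq_bigr => k _.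
    by rewrite !mxE.
  apply: is_derive_sum => k.
  have := derivableP (dphi k i) => dk.
  by apply: is_derive_eq; rewrite !mxE /GRing.scale /= /partial; ring.
have E (r : R) (s : R) : 0 <= s -> Num.sqrt s `^ r = s `^ (r / 2).
  by move=> s0; rewrite -powR12_sqrt// -powRrM mulrC.
have main (i : 'I_n) :
    partial i (fun y => (enorm (grad phi y) `^ (q - 2) *: grad phi y) 0 i) x
    = N `^ (q - 2) * hess phi x i i
      + (q - 2) * N `^ (q - 2) *
        \sum_k (grad phi x 0 k * hess phi x k i * grad phi x 0 i / S x).
  have -> : (fun y => (enorm (grad phi y) `^ (q - 2) *: grad phi y) 0 i) =
            (fun y => S y `^ ((q - 2) / 2)) * partial i phi.
    by apply/funext => y; rewrite !mxE /enorm E ?S_ge0.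
  have dP := is_derive_comp_real (is_derive1_powR ((q - 2) / 2) Sx0) (dS i).
  have di := derivableP (dphi i i).
  rewrite /partial derive_val.
  rewrite -/(partial i phi) /N /enorm E ?S_ge0 // -/(S x) !mxE.
  congr (_ + _).
  have -> : S x `^ ((q - 2) / 2 - 1) = S x `^ ((q - 2) / 2) / S x.
    by rewrite powRB ?powRr1 ?S_ge0// (gt_eqF Sx0) implybT.
  rewrite /GRing.scale /= !mulr_sumr; apply: eq_bigr => k _.
  by rewrite !mxE /partial; field; rewrite gt_eqF.
rewrite /norm_p_laplacian /plap_combination /norm_inf_laplacian /divergence.
rewrite (eq_bigr _ (fun i _ => main i)) big_split /= -!mulr_sumr.
have NN : N `^ (2 - q) * N `^ (q - 2) = 1.
  by rewrite -opprB powRN mulVf// gt_eqF ?powR_gt0.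
have -> : dot ((N^-1 *: grad phi x) *m hess phi x) (N^-1 *: grad phi x) =
    \sum_i \sum_k grad phi x 0 k * hess phi x k i * grad phi x 0 i / S x.
  rewrite /dot; apply: eq_bigr => i _.
  rewrite mxE mulr_suml; apply: eq_bigr => k _.
  by rewrite -N2 !mxE; field; rewrite gt_eqF.
rewrite -[laplacian phi x]/(\sum_i hess phi x i i).
set B := \sum_i \sum_k _; set A := \sum_i hess phi x i i.
transitivity (q^-1 * (N `^ (2 - q) * N `^ (q - 2)) * (A + (q - 2) * B)).
  by rewrite NN; field.
ring.
Qed.

Definition usc_on Omega u : Prop :=
  forall x, Omega x -> forall a, u x < a ->
    \forall y \near within Omega (nbhs x), u y < a.

Definition lsc_on Omega u : Prop :=
  forall x, Omega x -> forall a, a < u x ->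
    \forall y \near within Omega (nbhs x), a < u y.

Definition local_max_at Omega u x : Prop :=
  \forall y \near within Omega (nbhs x), u y <= u x.

Definition local_min_at Omega u x : Prop :=
  \forall y \near within Omega (nbhs x), u x <= u y.

Definition viscosity_subsolution p Omega f u : Prop :=
  usc_on Omega u /\
  forall x0 phi, Omega x0 -> C2 Omega phi -> local_max_at Omega (u \- phi) x0 ->
    (grad phi x0 != 0 -> - norm_p_laplacian p phi x0 <= f x0) /\
    (grad phi x0 = 0 ->
      - plap_combination p phi x0 (max_eigenvalue (hess phi x0)) <= f x0).

Definition viscosity_supersolution p Omega f u : Prop :=
  lsc_on Omega u /\
  forall x0 phi, Omega x0 -> C2 Omega phi -> local_min_at Omega (u \- phi) x0 ->
    (grad phi x0 != 0 -> f x0 <= - norm_p_laplacian p phi x0) /\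
    (grad phi x0 = 0 ->
      f x0 <= - plap_combination p phi x0 (min_eigenvalue (hess phi x0))).

Definition viscosity_solution p Omega f u : Prop :=
  viscosity_subsolution p Omega f u /\ viscosity_supersolution p Omega f u.

(* The boundary condition u = g is attained continuously: u lives on the
   closure of Omega and is continuous there. *)
Definition viscosity_dirichlet p Omega f g u : Prop :=
  [/\ viscosity_solution p Omega f u,
      {within closure Omega, continuous u}
    & forall x, boundary Omega x -> u x = g x].

End Defs.

(* Main.v *)
Require Import Defs.
From HB Require Import structures.
From mathcomp Require Import all_boot all_order all_algebra.
From mathcomp Require Import all_classical all_reals all_analysis.
From mathcomp Require Import ring lra.
Set Implicit Arguments.
Unset Strict Implicit.
Unset Printing Implicit Defensive.
Import Order.TTheory GRing.Theory Num.Theory.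
Import numFieldNormedType.Exports.
Local Open Scope classical_set_scope.
Local Open Scope ring_scope.

(** With gamma = (p - n)/(p - 1), the radial function A r^gamma - (B/2) r^2 is a
strict supersolution of the normalized p-Laplace equation away from its pole:
r^gamma is radially p-harmonic, and the quadratic term contributes
B (n + p - 2)/p >= B > sup |f_p|. Comparison with poles on the boundary, and then
with poles inside the domain, yields
u_p(x) - u_p(y) <= 2 sup |g_p - g| + A |x - y|^gamma with A independent of p:
only the Lipschitz constant of the limit g enters, the Hölder norms of the g_p do
not. The Arzelà-Ascoli argument gives a uniform limit u, which is Lipschitz
because gamma tends to 1. To see that u is a viscosity subsolution of the limit
equation, penalize the test function by |x - x0|^4, so that it touches u_p at
points tending to x0, and pass to the limit in the inequalities there; at
critical points both forms of the p-inequality are dominated by the largest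
eigenvalue of the (symmetric) Hessian, which is continuous. Supersolutions follow
by changing signs. *)

(** * Euclidean inner product and the Rayleigh quotient *)

(** Radial functions are written in s = |x - y|^2, so that polynomial profiles give C^2 functions on
    all of Omega, as a test function must be. The barrier itself is singular at its pole and can be
    used only through a parabola in s that dominates it near the touching point. The comparison uses
    only the inequality at nonzero gradients, so the barrier must have nonvanishing slope on the
    whole domain. With b = gamma/2 this is ensured by B D^2 < 2 A b, where D bounds the distances to
    the pole. Since gamma tends to 1, eventually b >= 1/4, and one A serves all large p. The term 2
    sup |g_p - g| does not vanish as y tends to x for fixed p. The estimates therefore give
    equicontinuity only in the joint limit y to x, p to infinity, and the compactness argument is
    formulated for that. Extremal eigenvalues are defined through the spectrum, while the limit
    argument needs their quadratic-form characterization. This requires symmetric Hessians, hence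
    Schwarz's theorem for the pointwise notion of C^2 used here. *)

Lemma cvg_sumr {R : realType} {I T : Type} (F : set_system T) (r : seq I)
    (f : I -> T -> R) (a : I -> R) : Filter F ->
  (forall i, f i @ F --> a i) ->
  (fun t => \sum_(i <- r) f i t) @ F --> \sum_(i <- r) a i.
Proof.
move=> FF fa; elim: r => [|i r IHr].
  rewrite big_nil (_ : (fun t => _) = cst 0); first exact: cvg_cst.
  by apply/funext => t; rewrite big_nil.
rewrite big_cons (_ : (fun t => _) = (fun t => f i t + \sum_(i <- r) f i t)).
  by apply: cvgD => //; exact: fa.
by apply/funext => t; rewrite big_cons.
Qed.

Lemma continuous_sumr {R : realType} {I : Type} {T : topologicalType}
    (r : seq I) (f : I -> T -> R) (x : T) :
  (forall i, {for x, continuous (f i)}) ->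
  {for x, continuous (fun t => \sum_(i <- r) f i t)}.
Proof. by move=> cf; apply: cvg_sumr => i; exact: cf. Qed.

Section Euclidean.
Context {R : realType} {n : nat}.
Implicit Types (v w x y : 'rV[R]_n) (X Y : 'M[R]_n).

Lemma dotC v w : dot v w = dot w v.
Proof. by apply: eq_bigr => i _; rewrite mulrC. Qed.

Lemma dotDl v w x : dot (v + w) x = dot v x + dot w x.
Proof. by rewrite -big_split; apply: eq_bigr => i _; rewrite !mxE mulrDl. Qed.

Lemma dotZl (a : R) v w : dot (a *: v) w = a * dot v w.
Proof. by rewrite /dot mulr_sumr; apply: eq_bigr => i _; rewrite mxE mulrA. Qed.

Lemma dotDr v w x : dot x (v + w) = dot x v + dot x w.
Proof. by rewrite dotC dotDl !(dotC x). Qed.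

Lemma dotZr (a : R) v w : dot w (a *: v) = a * dot w v.
Proof. by rewrite dotC dotZl dotC. Qed.

Lemma dotNl v w : dot (- v) w = - dot v w.
Proof. by rewrite -scaleN1r dotZl mulN1r. Qed.

Lemma dotNr v w : dot w (- v) = - dot w v.
Proof. by rewrite dotC dotNl dotC. Qed.

Lemma dot_ge0 v : 0 <= dot v v.
Proof. by apply: sumr_ge0 => i _; rewrite -expr2 sqr_ge0. Qed.

Lemma dot_eq0 v : (dot v v == 0) = (v == 0).
Proof.
apply/eqP/eqP => [|->]; last by rewrite /dot big1// => i _; rewrite mxE mul0r.
move=> /psumr_eq0P H; apply/rowP => i; rewrite [RHS]mxE.
have /eqP : v 0 i * v 0 i = 0 by apply: H => // j _; rewrite -expr2 sqr_ge0.
by rewrite mulf_eq0 orbb => /eqP.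
Qed.

Lemma dot_gt0 v : (0 < dot v v) = (v != 0).
Proof. by rewrite lt_def dot_ge0 andbT dot_eq0. Qed.

Lemma dot0l v : dot 0 v = 0.
Proof. by rewrite -(scale0r 0) dotZl mul0r. Qed.

Lemma sqr_enorm v : enorm v ^+ 2 = dot v v.
Proof. by rewrite /enorm sqr_sqrtr// dot_ge0. Qed.

Lemma enorm_ge0 v : 0 <= enorm v.
Proof. exact: sqrtr_ge0. Qed.

Lemma enorm0 : enorm (0 : 'rV[R]_n) = 0.
Proof. by rewrite /enorm dot0l sqrtr0. Qed.

Lemma enorm_gt0 v : (0 < enorm v) = (v != 0).
Proof. by rewrite /enorm sqrtr_gt0 dot_gt0. Qed.

Lemma enormN v : enorm (- v) = enorm v.
Proof. by rewrite /enorm dotNl dotNr opprK. Qed.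

Lemma enormB v w : enorm (v - w) = enorm (w - v).
Proof. by rewrite -enormN opprB. Qed.

Lemma norm_coord_le v i : `|v 0 i| <= `|v|.
Proof.
have /mapP[j Hj ->] : `|v 0 i| \in [seq `|v x.1 x.2| | x : 'I_1 * 'I_n].
  by apply/mapP; exists (ord0, i) => //=; rewrite mem_enum.
by rewrite [leRHS]/Num.norm /= mx_normrE; apply/bigmax_geP; right => /=; exists j.
Qed.

Lemma norm_coord_enorm v i : `|v 0 i| <= enorm v.
Proof.
rewrite -(ler_pXn2r (n := 2))// ?nnegrE ?enorm_ge0// sqr_enorm.
rewrite real_normK ?num_real// /dot (bigD1 i)//= expr2 lerDl.
by apply: sumr_ge0 => j _; rewrite -expr2 sqr_ge0.
Qed.

Lemma normr_le_enorm v : `|v| <= enorm v.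
Proof.
rewrite [leLHS]/Num.norm /= mx_normrE; apply/bigmax_leP; split=> [|[i j] _] /=.
  exact: enorm_ge0.
by rewrite (ord1 i) norm_coord_enorm.
Qed.

Lemma dotB_continuous y : continuous (fun x => dot (x - y) (x - y)).
Proof.
move=> x; apply: continuous_sumr => i.
have -> : (fun z : 'rV[R]_n => (z - y) 0 i * (z - y) 0 i) =
          (fun z => (z 0 i - y 0 i) * (z 0 i - y 0 i)).
  by apply/funext => z; rewrite !mxE.
suff c : {for x, continuous (fun z : 'rV[R]_n => z 0 i - y 0 i)}.
  exact: continuousM.
by apply: continuousB; [exact: coord_continuous|exact: cst_continuous].
Qed.

Lemma quad_form_continuous X : continuous (fun v => dot (v *m X) v).
Proof.
move=> x; apply: continuous_sumr => i.
have -> : (fun z : 'rV[R]_n => (z *m X) 0 i * z 0 i) =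
          (fun z => (\sum_j z 0 j * X j i) * z 0 i).
  by apply/funext => z; rewrite !mxE.
apply: continuousM; last exact: coord_continuous.
apply: continuous_sumr => j.
by apply: continuousM; [exact: coord_continuous|exact: cst_continuous].
Qed.

Lemma dot_mulmx_sym X v w : X^T = X -> dot (v *m X) w = dot (w *m X) v.
Proof.
move=> sX; rewrite /dot.
transitivity (\sum_i \sum_j v 0 j * X j i * w 0 i).
  by apply: eq_bigr => i _; rewrite mxE mulr_suml.
rewrite exchange_big; apply: eq_bigr => i _; rewrite mxE mulr_suml.
by apply: eq_bigr => j _; rewrite -{1}sX mxE; ring.
Qed.

Lemma quad_formD X Y v : dot (v *m (X + Y)) v = dot (v *m X) v + dot (v *m Y) v.
Proof. by rewrite mulmxDr dotDl. Qed.

Lemma quad_form_le_entries X v :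
  dot (v *m X) v <= (\sum_i \sum_j `|X i j|) * dot v v.
Proof.
have -> : dot (v *m X) v = \sum_i \sum_j v 0 j * X j i * v 0 i.
  by apply: eq_bigr => i _; rewrite mxE mulr_suml.
rewrite exchange_big mulr_suml; apply: ler_sum => i _.
rewrite mulr_suml; apply: ler_sum => j _.
rewrite (le_trans (ler_norm _))// !normrM mulrAC mulrC ler_wpM2l//.
by rewrite -sqr_enorm expr2 ler_pM// norm_coord_enorm.
Qed.

Lemma unit_vector_exists : (0 < n)%N -> exists v : 'rV[R]_n, dot v v = 1.
Proof.
move=> n0; exists (delta_mx 0 (Ordinal n0)).
rewrite /dot (bigD1 (Ordinal n0))//= big1 => [|i /negPf ni].
  by rewrite !mxE !eqxx addr0 mulr1.
by rewrite !mxE ni andbF mulr0.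
Qed.

Lemma unit_sphere_compact : compact [set v : 'rV[R]_n | dot v v = 1].
Proof.
apply: bounded_closed_compact.
  exists 1; split; first exact: num_real.
  move=> M M1 v /= v1; apply: le_trans (ltW M1).
  by rewrite (le_trans (normr_le_enorm v))// /enorm v1 sqrtr1.
have -> : [set v : 'rV[R]_n | dot v v = 1] =
    (fun v => dot (v - 0) (v - 0)) @^-1` [set 1].
  by apply/seteqP; split => v /=; rewrite subr0.
apply: closed_comp; last exact: closed_eq.
by move=> v _; exact: dotB_continuous.
Qed.

(* At a maximiser [v] of the Rayleigh quotient the form [a |w|^2 - <wX, w>] is
   nonnegative and vanishes at [v]; its first variation there must vanish. *)
Lemma rayleigh_max X : (0 < n)%N -> X^T = X ->
  exists (a : R) (v : 'rV[R]_n),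
    [/\ v != 0, v *m X = a *: v & forall w, dot (w *m X) w <= a * dot w w].
Proof.
move=> n0 sX.
have [v /set_mem /= v1 vmax] : exists2 v, v \in [set v : 'rV[R]_n | dot v v = 1] &
    forall w, w \in [set v : 'rV[R]_n | dot v v = 1] ->
    dot (w *m X) w <= dot (v *m X) v.
  apply: EVT_max_rV; [exact: unit_vector_exists|exact: unit_sphere_compact|].
  exact/continuous_subspaceT/quad_form_continuous.
set a := dot (v *m X) v in vmax.
have Ha w : dot (w *m X) w <= a * dot w w.
  have [->|w0] := eqVneq w 0; first by rewrite mul0mx !dot0l mulr0.
  have e0 : 0 < enorm w by rewrite enorm_gt0.
  have := vmax ((enorm w)^-1 *: w).
  rewrite -scalemxAl !dotZl !dotZr => H.
  have {H} := H _; rewrite mulrA -expr2 => H.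
  have: (enorm w)^-1 ^+ 2 * dot (w *m X) w <= a.
    by apply: H; apply/mem_set => /=; rewrite dotZl dotZr -sqr_enorm; field; rewrite gt_eqF.
  by rewrite exprVn mulrC ler_pdivrMr ?exprn_gt0// -sqr_enorm.
exists a, v; split=> //; first by rewrite -dot_gt0 v1.
pose z := a *: v - v *m X.
suff : z = 0 by move/eqP; rewrite subr_eq0 => /eqP.
apply/eqP; rewrite -dot_eq0; apply/eqP.
have vXz : dot (v *m X) z = a * dot v z - dot z z.
  have -> : dot z z = dot (a *: v - v *m X) z by [].
  by rewrite dotDl dotNl dotZl; ring.
move: z vXz => z vXz.
(* 0 <= a |v + t z|^2 - <(v + t z) X, v + t z> = 2 t |z|^2 + t^2 c *)
pose c := a * dot z z - dot (z *m X) z.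
have key t : 0 <= 2 * t * dot z z + t ^+ 2 * c.
  have := Ha (v + t *: z); rewrite -subr_ge0.
  rewrite mulmxDl !dotDl !dotDr -!scalemxAl !dotZl !dotZr (dot_mulmx_sym z v sX).
  rewrite v1 (dotC z v).
  by rewrite -/a vXz; congr (_ <= _); rewrite /c; ring.
have c0 : 0 <= c by rewrite subr_ge0.
apply/eqP; rewrite eq_le dot_ge0 andbT leNgt; apply/negP => z0.
(* The quadratic in t is minimal at -|z|^2 / c; [c + 1] avoids division by zero and still gives a
   negative value. *)
have := key (- (dot z z / (c + 1))).
apply/negP; rewrite -ltNge.
have -> : 2 * - (dot z z / (c + 1)) * dot z z + (- (dot z z / (c + 1))) ^+ 2 * c =
  - ((dot z z) ^+ 2 / (c + 1) ^+ 2 * (c + 2)) by field; rewrite gt_eqF// ltr_wpDl.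
by rewrite oppr_lt0 mulr_gt0 ?divr_gt0 ?exprn_gt0 ?ltr_wpDl.
Qed.

(** The maximal Rayleigh value is an eigenvalue, and its inequality tested at any other eigenvector
    bounds the corresponding eigenvalue; so the supremum of the spectrum is that value. *)
Lemma max_eigenvalue_rayleigh X : (0 < n)%N -> X^T = X ->
  exists2 v : 'rV[R]_n, v != 0 & v *m X = max_eigenvalue X *: v /\
    forall w, dot (w *m X) w <= max_eigenvalue X * dot w w.
Proof.
move=> n0 sX; have [a [v [v0 va amax]]] := rayleigh_max n0 sX.
suff -> : max_eigenvalue X = a by exists v.
have ea : [set a | eigenvalue X a] a by apply/eigenvalueP; exists v.
have ub : ubound [set a | eigenvalue X a] a.
  move=> b /eigenvalueP[w wb w0]; have := amax w.
  by rewrite wb dotZl ler_pM2r// dot_gt0.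
apply/eqP; rewrite eq_le ge_sup//=; last by exists a.
by rewrite ub_le_sup//; exists a.
Qed.

Lemma quad_form_le_max_eigenvalue X v : (0 < n)%N -> X^T = X ->
  dot (v *m X) v <= max_eigenvalue X * dot v v.
Proof. by move=> n0 sX; have [? _ []] := max_eigenvalue_rayleigh n0 sX. Qed.

(** Weyl's perturbation bound, by testing the form at a top eigenvector of [X]. The entrywise sum is
    a crude norm, but it tends to 0 with the entries, which is what continuity requires. *)
Lemma max_eigenvalue_le X Y : (0 < n)%N -> X^T = X -> Y^T = Y ->
  max_eigenvalue X <= max_eigenvalue Y + \sum_i \sum_j `|X i j - Y i j|.
Proof.
move=> n0 sX sY; have [v v0 [vX _]] := max_eigenvalue_rayleigh n0 sX.
rewrite -(@ler_pM2r _ (dot v v)) ?dot_gt0// -dotZl -vX mulrDl.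
rewrite -{1}(subrK Y X) quad_formD addrC lerD ?quad_form_le_max_eigenvalue//.
rewrite (le_trans (quad_form_le_entries _ _))//.
by under eq_bigr do under eq_bigr do rewrite !mxE.
Qed.

Lemma min_eigenvalueN X : min_eigenvalue (- X) = - max_eigenvalue X.
Proof.
rewrite /min_eigenvalue /max_eigenvalue /inf; congr (- sup _).
have evN (Y : 'M[R]_n) a : eigenvalue Y a -> eigenvalue (- Y) (- a).
  move=> /eigenvalueP[v vY v0]; apply/eigenvalueP; exists v => //.
  by rewrite mulmxN vY scaleNr.
apply/seteqP; split=> a /=.
  by case=> b bX <-; rewrite -[X in eigenvalue X _]opprK; exact: evN.
by move=> aX; exists (- a); rewrite ?opprK//; exact: evN.
Qed.

End Euclidean.

(** * Symmetry of the Hessian *)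

Section Schwarz.
Context {R : realType} {V : normedModType R}.
Implicit Types (F : V -> R) (x e : V).

Lemma is_derive_line F x e (t : R) : derivable F (t *: e + x) e ->
  is_derive t (1 : R) (fun r : R => F (r *: e + x)) ('D_e F (t *: e + x)).
Proof.
move=> dF.
have E : (fun h : R => h^-1 *: (F ((h *: 1 + t) *: e + x) - F (t *: e + x))) =
         (fun h : R => h^-1 *: (F (h *: e + (t *: e + x)) - F (t *: e + x))).
  by apply/funext => h; rewrite [h%:A]mulr1 scalerDl addrA.
by split; rewrite ?/derivable ?/derive E.
Qed.

(** Mean value theorem twice: along [e] for the increment of [F] in direction [e'], then along [e']
    for the derivative in direction [e]. *)
Lemma second_difference_mean_value F x e e' (s : R) : 0 < s ->
  (forall a b, 0 <= a <= s -> 0 <= b <= s ->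
    derivable F (a *: e + (b *: e' + x)) e /\
    derivable ('D_e F) (a *: e + (b *: e' + x)) e') ->
  exists a b, [/\ 0 <= a <= s, 0 <= b <= s &
    F (s *: e + (s *: e' + x)) - F (s *: e + x) - (F (s *: e' + x) - F x) =
    s ^+ 2 * 'D_e' ('D_e F) (a *: e + (b *: e' + x))].
Proof.
move=> s0 dF.
have s0' : 0 <= (0 : R) <= s by rewrite lexx ltW.
have ss : 0 <= s <= s by rewrite lexx ltW.
pose G := (fun r : R => F (r *: e + (s *: e' + x))) - (fun r : R => F (r *: e + x)).
pose dG (t : R) := 'D_e F (t *: e + (s *: e' + x)) - 'D_e F (t *: e + x).
have GdG t : 0 <= t <= s -> is_derive t (1 : R) G (dG t).
  move=> ts; apply: is_deriveB; apply: is_derive_line.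
    by have [] := dF t s ts ss.
  by have [] := dF t 0 ts s0'; rewrite scale0r add0r.
have Itv t : t \in `]0, s[ -> 0 <= t <= s.
  by rewrite in_itv /= => /andP[t0 ts]; rewrite !ltW.
have Itvc t : t \in `[0, s] -> 0 <= t <= s by rewrite in_itv.
have [a /Itv a0s GE] : exists2 a, a \in `]0, s[ & G s - G 0 = dG a * (s - 0).
  apply: (@MVT R G dG 0 s s0) => [t /Itv ts|]; first exact: GdG.
  apply: derivable_within_continuous => t /Itvc ts.
  by have [] := GdG t ts.
pose H := fun r : R => 'D_e F (r *: e' + (a *: e + x)).
pose dH (t : R) := 'D_e' ('D_e F) (t *: e' + (a *: e + x)).
have HdH t : 0 <= t <= s -> is_derive t (1 : R) H (dH t).
  move=> ts; apply: is_derive_line; rewrite addrCA.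
  by have [] := dF a t a0s ts.
have [b /Itv b0s HE] : exists2 b, b \in `]0, s[ & H s - H 0 = dH b * (s - 0).
  apply: (@MVT R H dH 0 s s0) => [t /Itv ts|]; first exact: HdH.
  apply: derivable_within_continuous => t /Itvc ts.
  by have [] := HdH t ts.
exists a, b; split=> //.
transitivity (G s - G 0); first by rewrite /G !fctE scale0r !add0r.
rewrite GE.
have -> : dG a = H s - H 0 by rewrite /dG /H scale0r add0r (addrCA (s *: e')).
by rewrite HE /dH (addrCA (b *: e')) subr0; ring.
Qed.

Lemma derive_swap F x e e' :
  (\forall y \near x, [/\ derivable F y e, derivable F y e',
     derivable ('D_e F) y e' & derivable ('D_e' F) y e]) ->
  {for x, continuous ('D_e' ('D_e F))} -> {for x, continuous ('D_e ('D_e' F))} ->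
  'D_e' ('D_e F) x = 'D_e ('D_e' F) x.
Proof.
move=> dF c1 c2; apply/eqP/contraT => ne.
set A := 'D_e' ('D_e F) x in ne *; set B := 'D_e ('D_e' F) x in ne *.
have d0 : 0 < `|A - B| / 2 by rewrite divr_gt0// normr_gt0 subr_eq0.
have /cvgrPdist_lt/(_ _ d0) n1 := c1.
have /cvgrPdist_lt/(_ _ d0) n2 := c2.
have : \forall y \near x, [/\ derivable F y e, derivable F y e',
     derivable ('D_e F) y e' & derivable ('D_e' F) y e] /\
     (`|A - 'D_e' ('D_e F) y| < `|A - B| / 2 /\
      `|B - 'D_e ('D_e' F) y| < `|A - B| / 2).
  exact: (filterI dF (filterI n1 n2)).
move=> /nbhs_ballP[r /= r0 near_r].
(* Small enough for the parallelogram with sides s e, s e' to stay in the ball; the added 1 covers e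
   = e' = 0. *)
pose s := r / (`|e| + `|e'| + 1) / 2.
have N0 : 0 < `|e| + `|e'| + 1 by rewrite ltr_wpDl// addr_ge0.
have s0 : 0 < s by rewrite !divr_gt0.
have inb a b : 0 <= a <= s -> 0 <= b <= s -> ball x r (a *: e + (b *: e' + x)).
  move=> /andP[a0 a1] /andP[b0 b1].
  rewrite -ball_normE /ball_ /= addrA opprD addrCA subrr addr0 normrN.
  rewrite (le_lt_trans (ler_normD _ _))// !normrZ !ger0_norm//.
  apply: (@le_lt_trans _ _ (s * (`|e| + `|e'|))).
    by rewrite mulrDr lerD// ler_wpM2r.
  rewrite (@le_lt_trans _ _ (s * (`|e| + `|e'| + 1)))//.
    by rewrite ler_wpM2l ?ltW// ltrDl.
  by rewrite /s mulrAC divfK ?gt_eqF// ltr_pdivrMr// ltr_pMr// ltr1n.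
have [a [b [ha hb E1]]] := @second_difference_mean_value F x e e' s s0
  (fun a b ha hb => let: conj (And4 d1 _ d2 _) _ := near_r _ (inb a b ha hb) in
    conj d1 d2).
have inb' a' b' : 0 <= a' <= s -> 0 <= b' <= s ->
    ball x r (a' *: e' + (b' *: e + x)).
  by move=> ? ?; rewrite addrCA; exact: inb.
have [a' [b' [ha' hb' E2]]] := @second_difference_mean_value F x e' e s s0
  (fun a b ha hb => let: conj (And4 _ d1 _ d2) _ := near_r _ (inb' a b ha hb) in
    conj d1 d2).
have [_ [nA _]] := near_r _ (inb _ _ ha hb).
have [_ [_ nB]] := near_r _ (inb' _ _ ha' hb').
set A' := 'D_e' ('D_e F) _ in E1 nA; set B' := 'D_e ('D_e' F) _ in E2 nB.
clearbody A B A' B'.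
have swap (a1 a2 a3 a4 : R) : a1 - a2 - (a3 - a4) = a1 - a3 - (a2 - a4) by ring.
have AB : A' = B'.
  have : s ^+ 2 * A' = s ^+ 2 * B' by rewrite -E1 -E2 (addrCA (s *: e')) swap.
  by apply: mulfI; rewrite expf_neq0// gt_eqF.
move: nA; rewrite AB distrC => nA.
have := ltrD nA nB; rewrite -splitr (distrC _ A) (distrC B) => nAB.
have := le_lt_trans (ler_distD B' A B) nAB.
by rewrite ltxx.
Qed.

End Schwarz.

Lemma hess_sym {R : realType} {n : nat} (Omega : set 'rV[R]_n) phi x :
  open Omega -> C2 Omega phi -> Omega x -> (hess phi x)^T = hess phi x.
Proof.
move=> oO C2phi Ox; apply/matrixP => i j; rewrite !mxE.
have [_ _ c2] := C2phi x Ox.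
apply: derive_swap; [|by have [] := c2 j i|by have [] := c2 i j].
have : \forall y \near x, Omega y by apply: open_nbhs_nbhs.
apply: filterS => y /C2phi[_ h1 h2].
by split; [have [] := h1 j|have [] := h1 i|have [] := h2 j i|have [] := h2 i j].
Qed.

(** * Radial test functions *)

Section Radial.
Context {R : realType} {n : nat}.
Implicit Types (x y v : 'rV[R]_n).

Lemma is_derive_coord x v k :
  is_derive x v (fun z : 'rV[R]_n => z 0 k) (v 0 k).
Proof.
have H : (fun h : R => h^-1 *: ((h *: v + x) 0 k - x 0 k)) @ 0^' --> v 0 k.
  apply: cvg_near_cst; near=> h.
  rewrite !mxE addrK /GRing.scale /= mulrA mulVf ?mul1r//.
  by near: h; exact: nbhs_dnbhs_neq.
by split; [apply/cvg_ex; exists (v 0 k)|exact: cvg_lim].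
Unshelve. all: by end_near. Qed.

Lemma is_derive_coordB y x v k :
  is_derive x v (fun z : 'rV[R]_n => (z - y) 0 k) (v 0 k).
Proof.
have -> : (fun z : 'rV[R]_n => (z - y) 0 k) =
    (fun z : 'rV[R]_n => z 0 k) - cst (y 0 k).
  by apply/funext => z; rewrite !mxE.
have H := is_derive_coord x v k.
by apply: is_derive_eq; rewrite subr0.
Qed.

Lemma is_derive_sqdist y x i :
  is_derive x (delta_mx 0 i) (fun z : 'rV[R]_n => dot (z - y) (z - y))
    (2 * (x - y) 0 i).
Proof.
have -> : (fun z : 'rV[R]_n => dot (z - y) (z - y)) =
    \sum_k ((fun z : 'rV[R]_n => (z - y) 0 k) * (fun z : 'rV[R]_n => (z - y) 0 k)).
  by apply/funext => z; rewrite fct_sumE.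
have H k : is_derive x (delta_mx 0 i) ((fun z : 'rV[R]_n => (z - y) 0 k) *
    (fun z : 'rV[R]_n => (z - y) 0 k)) ((2 * (x - y) 0 i) *+ (k == i)).
  have Hk := is_derive_coordB y x (delta_mx 0 i) k.
  apply: is_derive_eq; rewrite /GRing.scale /= [in (_ *+ _)]mxE !mxE eqxx /=.
  by case: eqVneq => [->|_]; rewrite ?mulr1n ?mulr0n; ring.
rewrite -[X in is_derive _ _ _ X](_ : \sum_k (2 * (x - y) 0 i) *+ (k == i) = _).
  exact: is_derive_sum.
by rewrite (bigD1 i)//= eqxx mulr1n big1 ?addr0// => k /negPf ->.
Qed.

Context {P P1 P2 : R -> R}.
Hypothesis dP : forall s : R, is_derive s (1 : R) P (P1 s).
Hypothesis dP1 : forall s : R, is_derive s (1 : R) P1 (P2 s).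
Hypothesis cP2 : continuous P2.

(** A profile of the squared distance: smoothness of [P] on the line gives smoothness everywhere,
    the pole included. *)
Definition radial y x : R := P (dot (x - y) (x - y)).

Lemma is_derive_radial y x i : is_derive x (delta_mx 0 i) (radial y)
  (2 * P1 (dot (x - y) (x - y)) * (x - y) 0 i).
Proof.
have := is_derive_comp_real (dP _) (is_derive_sqdist y x i).
by rewrite (_ : P1 _ * _ = 2 * P1 (dot (x - y) (x - y)) * (x - y) 0 i)//; ring.
Qed.

Lemma partial_radial y i : partial i (radial y) =
  (fun x => 2 * P1 (dot (x - y) (x - y)) * (x - y) 0 i).
Proof.
by apply/funext => x; have H := is_derive_radial y x i; exact: derive_val.
Qed.

Lemma is_derive_partial_radial y x i j :
  is_derive x (delta_mx 0 j) (partial i (radial y))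
    (4 * P2 (dot (x - y) (x - y)) * ((x - y) 0 i * (x - y) 0 j)
     + 2 * P1 (dot (x - y) (x - y)) *+ (i == j)).
Proof.
have h1 := is_derive_comp_real (dP1 _) (is_derive_sqdist y x j).
have h2 := is_derive_coordB y x (delta_mx 0 j) i.
rewrite partial_radial.
have -> : (fun z => 2 * P1 (dot (z - y) (z - y)) * (z - y) 0 i) =
  2 *: ((fun z => P1 (dot (z - y) (z - y))) * (fun z => (z - y) 0 i)).
  by apply/funext => z; rewrite !fctE /GRing.scale /=; ring.
apply: is_derive_eq; rewrite /GRing.scale /= [delta_mx _ _ _ _]mxE eqxx /=.
by case: eqVneq => _; rewrite ?mulr1n ?mulr0n /=; ring.
Qed.

Lemma hess_radialE y x i j : hess (radial y) x i j =
  4 * P2 (dot (x - y) (x - y)) * ((x - y) 0 i * (x - y) 0 j)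
  + 2 * P1 (dot (x - y) (x - y)) *+ (i == j).
Proof.
by rewrite mxE; have H := is_derive_partial_radial y x i j; exact: derive_val.
Qed.

Lemma coordB_continuous y i : continuous (fun z : 'rV[R]_n => (z - y) 0 i).
Proof.
move=> x; have -> : (fun z : 'rV[R]_n => (z - y) 0 i) =
   (fun z : 'rV[R]_n => z 0 i - y 0 i) by apply/funext => z; rewrite !mxE.
by apply: continuousB; [exact: coord_continuous|exact: cst_continuous].
Qed.

Lemma comp_sqdist_continuous (Q : R -> R) y x :
  {for dot (x - y) (x - y), continuous Q} ->
  {for x, continuous (fun z : 'rV[R]_n => Q (dot (z - y) (z - y)))}.
Proof.
by move=> cQ; apply: (@continuous_comp _ _ _ (fun z : 'rV[R]_n => dot (z - y) (z - y)) Q);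
  [exact: dotB_continuous|].
Qed.

Lemma C2_radial Omega y : C2 Omega (radial y).
Proof.
move=> x _.
have cont (Q Q' : R -> R) : (forall s : R, is_derive s (1 : R) Q (Q' s)) ->
    continuous Q.
  move=> dQ s; apply/differentiable_continuous/derivable1_diffP.
  by have [] := dQ s.
split=> [|i|i j].
- by apply: comp_sqdist_continuous; exact: (cont _ _ dP).
- split; first by have [] := is_derive_radial y x i.
  rewrite partial_radial.
  apply: continuousM; last exact: coordB_continuous.
  apply: continuousM; first exact: cst_continuous.
  by apply: comp_sqdist_continuous; exact: (cont _ _ dP1).
- split; first by have [] := is_derive_partial_radial y x i j.
  have -> : partial j (partial i (radial y)) = (fun x =>
    4 * P2 (dot (x - y) (x - y)) * ((x - y) 0 i * (x - y) 0 j)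
    + 2 * (P1 (dot (x - y) (x - y)) *+ (i == j))).
    by apply/funext => z; have := hess_radialE y z i j; rewrite mxE mulrnAr.
  apply: continuousD; apply: continuousM.
  + apply: continuousM; first exact: cst_continuous.
    by apply: comp_sqdist_continuous; exact: cP2.
  + by apply: continuousM; exact: coordB_continuous.
  + exact: cst_continuous.
  + case: (i == j).
      by apply: (@comp_sqdist_continuous P1); exact: (cont _ _ dP1).
    exact: (@cst_continuous _ _ (0 : R)).
Qed.

Lemma grad_radial y x :
  grad (radial y) x = (2 * P1 (dot (x - y) (x - y))) *: (x - y).
Proof. by apply/rowP => i; rewrite !mxE partial_radial !mxE. Qed.

Lemma hess_radial y x : hess (radial y) x =
  (4 * P2 (dot (x - y) (x - y))) *: ((x - y)^T *m (x - y))
  + (2 * P1 (dot (x - y) (x - y)))%:M.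
Proof.
by apply/matrixP => i j; rewrite hess_radialE !mxE big_ord1 !mxE.
Qed.

Lemma laplacian_radial y x : laplacian (radial y) x =
  4 * P2 (dot (x - y) (x - y)) * dot (x - y) (x - y)
  + n%:R * (2 * P1 (dot (x - y) (x - y))).
Proof.
rewrite /laplacian /mxtrace.
under eq_bigr do rewrite hess_radialE eqxx mulr1n.
by rewrite big_split /= -mulr_sumr sumr_const card_ord -[_ *+ n]mulr_natl.
Qed.

(** The right side is the second derivative of P(r^2) in r: the gradient is a nonzero multiple of x
    - y, on which the rank-one part of the Hessian acts fully. *)
Lemma norm_inf_laplacian_radial y x :
  P1 (dot (x - y) (x - y)) != 0 -> x != y ->
  norm_inf_laplacian (radial y) x =
  4 * P2 (dot (x - y) (x - y)) * dot (x - y) (x - y)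
  + 2 * P1 (dot (x - y) (x - y)).
Proof.
move=> P10 xy; rewrite /norm_inf_laplacian grad_radial hess_radial.
set s := dot (x - y) (x - y) in P10 *; set d := x - y in s P10 *.
have s0 : 0 < s by rewrite dot_gt0 subr_eq0.
move gE : ((2 * P1 s) *: d) => g; have gg : dot g g = (2 * P1 s) ^+ 2 * s.
  by rewrite -gE dotZl dotZr mulrA -expr2.
have gg0 : 0 < dot g g.
  by rewrite gg mulr_gt0// exprn_even_gt0//= mulf_neq0// pnatr_eq0.
rewrite -scalemxAl dotZl dotZr mulrA -expr2 exprVn sqr_enorm.
rewrite quad_formD mul_mx_scalar dotZl.
have -> : dot (g *m ((4 * P2 s) *: (d^T *m d))) g = 4 * P2 s * (2 * P1 s) ^+ 2 * s ^+ 2.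
  rewrite -scalemxAr dotZl mulmxA.
  have -> : g *m d^T = (dot g d)%:M.
    apply/matrixP => i j; rewrite (ord1 i) (ord1 j) [LHS]mxE [RHS]mxE eqxx mulr1n.
    by apply: eq_bigr => k _; rewrite [_^T _ _]mxE.
  by rewrite mul_scalar_mx dotZl -gE dotZl dotZr -/s; ring.
by rewrite gg; field; rewrite P10 gt_eqF.
Qed.

End Radial.

Arguments radial {R n} P y x.

(** * Linear combinations and change of sign *)

Section LinearCombination.
Context {R : realType} {n : nat} (Omega : set 'rV[R]_n) (a : R).
Context {phi psi : 'rV[R]_n -> R}.
Hypothesis (oO : open Omega).
Hypothesis (cphi : C2 Omega phi) (cpsi : C2 Omega psi).

Let near_Omega x : Omega x -> \forall y \near x, Omega y.
Proof. by move=> Ox; exact: open_nbhs_nbhs. Qed.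

Let is_derive_lin (f g : 'rV[R]_n -> R) x v : derivable f x v -> derivable g x v ->
  is_derive x v (a *: f + g) (a * 'D_v f x + 'D_v g x).
Proof. by move=> /derivableP df /derivableP dg; apply: is_derive_eq. Qed.

Lemma partial_lin x i : Omega x ->
  partial i (a *: phi + psi) x = a * partial i phi x + partial i psi x.
Proof.
move=> Ox; have [_ /(_ i)[d1 _] _] := cphi Ox.
have [_ /(_ i)[d2 _] _] := cpsi Ox.
by have H := is_derive_lin d1 d2; rewrite /partial derive_val.
Qed.

(** The first-order identity is available only inside [Omega]; differentiating it again requires it
    on a neighbourhood of [x], whence [open Omega]. *)
Let near_partial x i : Omega x -> {near x,
  a *: partial i phi + partial i psi =1 partial i (a *: phi + psi)}.
Proof.
move=> Ox; apply: filterS (near_Omega Ox) => y Oy.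
by rewrite partial_lin.
Qed.

Let is_derive_partial_lin x i j : Omega x ->
  is_derive x (delta_mx 0 j) (partial i (a *: phi + psi))
    (a * partial j (partial i phi) x + partial j (partial i psi) x).
Proof.
move=> Ox; have [_ _ /(_ i j)[d1 _]] := cphi Ox.
have [_ _ /(_ i j)[d2 _]] := cpsi Ox.
have H := is_derive_lin d1 d2.
apply: near_eq_is_derive H; last exact: near_partial.
Qed.

Lemma grad_lin x : Omega x ->
  grad (a *: phi + psi) x = a *: grad phi x + grad psi x.
Proof. by move=> Ox; apply/rowP => i; rewrite !mxE partial_lin. Qed.

Lemma hess_lin x : Omega x ->
  hess (a *: phi + psi) x = a *: hess phi x + hess psi x.
Proof.
move=> Ox; apply/matrixP => i j.
have H := is_derive_partial_lin i j Ox.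
rewrite [LHS]mxE [LHS]derive_val [RHS]mxE; congr (_ + _).
  by rewrite [RHS]mxE; congr (_ * _); rewrite [RHS]mxE.
by rewrite [RHS]mxE.
Qed.

Let continuous_lin (f g h : 'rV[R]_n -> R) x :
  {for x, continuous f} -> {for x, continuous g} ->
  {near x, a *: f + g =1 h} -> {for x, continuous h}.
Proof.
move=> cf cg E; rewrite /prop_for /continuous_at -(nbhs_singleton E).
apply: cvg_trans (near_eq_cvg E) _.
by apply: (continuousD _ cg); exact: continuousZr.
Qed.

Lemma C2_lin : C2 Omega (a *: phi + psi).
Proof.
move=> x Ox; have [c1 c2 c3] := cphi Ox; have [k1 k2 k3] := cpsi Ox; split.
- apply: (continuous_lin c1 k1); exact: (filterS (fun y _ => erefl) (near_Omega Ox)).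

- move=> i; have [d1 e1] := c2 i; have [d2 e2] := k2 i; split.
    by have [] := is_derive_lin d1 d2.
  exact: (continuous_lin e1 e2 (near_partial i Ox)).
- move=> i j; split; first by have [] := is_derive_partial_lin i j Ox.
  have [_ e1] := c3 i j; have [_ e2] := k3 i j.
  apply: continuous_lin e1 e2 _.
  apply: filterS (near_Omega Ox) => y Oy.
  by have H := is_derive_partial_lin i j Oy; rewrite /partial derive_val.
Qed.

End LinearCombination.

Section Negation.
Context {R : realType} {n : nat} {Omega : set 'rV[R]_n}.
Hypothesis oO : open Omega.
Implicit Types (p : \bar R) (f u phi : 'rV[R]_n -> R).

Lemma C2_cst (c : R) : C2 Omega (cst c).
Proof.
have E i : partial i (cst c : 'rV[R]_n -> R) = cst 0.
  by apply/funext => x; rewrite /partial derive_cst.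
move=> x _; split=> [|i|i j]; first exact: cst_continuous.
  by split; [exact: derivable_cst|rewrite E; exact: cst_continuous].
rewrite E; split; first exact: derivable_cst.
have -> : partial j (cst 0 : 'rV[R]_n -> R) = cst 0.
  by apply/funext => y; rewrite /partial derive_cst.
exact: cst_continuous.
Qed.

(** Puts negation into the form covered by the results on linear combinations. *)
Let opp_lin phi : - phi = -1 *: phi + cst 0.
Proof. by apply/funext => x; rewrite !fctE scaleN1r addr0. Qed.

Let grad_cst0 x : grad (cst 0 : 'rV[R]_n -> R) x = 0.
Proof. by apply/rowP => i; rewrite !mxE /partial derive_cst. Qed.

Let hess_cst0 x : hess (cst 0 : 'rV[R]_n -> R) x = 0.
Proof.
apply/matrixP => i j; rewrite !mxE.
have -> : partial i (cst 0 : 'rV[R]_n -> R) = cst 0.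
  by apply/funext => y; rewrite /partial derive_cst.
by rewrite /partial derive_cst.
Qed.

Lemma C2N phi : C2 Omega phi -> C2 Omega (- phi).
Proof. by move=> cphi; rewrite opp_lin; exact: (C2_lin (-1) oO cphi (C2_cst 0)). Qed.

Lemma gradN phi x : C2 Omega phi -> Omega x -> grad (- phi) x = - grad phi x.
Proof.
move=> cphi Ox; rewrite opp_lin (grad_lin (-1) cphi (C2_cst 0) Ox).
by rewrite grad_cst0 addr0 scaleN1r.
Qed.

Lemma hessN phi x : C2 Omega phi -> Omega x -> hess (- phi) x = - hess phi x.
Proof.
move=> cphi Ox; rewrite opp_lin (hess_lin (-1) oO cphi (C2_cst 0) Ox).
by rewrite hess_cst0 addr0 scaleN1r.
Qed.

Lemma norm_inf_laplacianN phi x : C2 Omega phi -> Omega x ->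
  norm_inf_laplacian (- phi) x = - norm_inf_laplacian phi x.
Proof.
move=> cphi Ox; rewrite /norm_inf_laplacian gradN// hessN// enormN.
by rewrite scalerN mulmxN mulNmx opprK dotNr.
Qed.

Lemma plap_combinationN p phi x l : C2 Omega phi -> Omega x ->
  plap_combination p (- phi) x (- l) = - plap_combination p phi x l.
Proof.
move=> cphi Ox; case: p => //= q.
rewrite /laplacian hessN// (_ : \tr (- hess phi x) = - \tr (hess phi x)); last exact: raddfN.
by ring.
Qed.

Lemma viscosity_subsolutionN p f u : viscosity_supersolution p Omega f u ->
  viscosity_subsolution p Omega (- f) (- u).
Proof.
move=> [lu su]; split.
  move=> x Ox a; rewrite fctE ltrNl => /(lu _ Ox).
  by apply: filterS => y uy; suff : - u y < a by []; rewrite ltrNl.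
move=> x phi Ox cphi mx.
have {}mx : local_min_at Omega (u \- - phi) x.
  by apply: filterS mx => y; rewrite /= !fctE; lra.
have [s1 s2] := su x _ Ox (C2N cphi) mx.
split=> [g0|g0].
  rewrite lerNr (le_trans (s1 _))//; first by rewrite gradN// oppr_eq0.
  by rewrite /norm_p_laplacian norm_inf_laplacianN// plap_combinationN ?opprK.
rewrite lerNr (le_trans (s2 _))//; first by rewrite gradN// g0 oppr0.
by rewrite hessN// min_eigenvalueN plap_combinationN ?opprK.
Qed.

Lemma viscosity_supersolutionN p f u : viscosity_subsolution p Omega f u ->
  viscosity_supersolution p Omega (- f) (- u).
Proof.
move=> [lu su]; split.
  move=> x Ox a; rewrite fctE ltrNr => /(lu _ Ox).
  by apply: filterS => y uy; suff : a < - u y by []; rewrite ltrNr.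
move=> x phi Ox cphi mx.
have {}mx : local_max_at Omega (u \- - phi) x.
  by apply: filterS mx => y; rewrite /= !fctE; lra.
have [s1 s2] := su x _ Ox (C2N cphi) mx.
split=> [g0|g0].
  rewrite lerN2 (le_trans _ (s1 _))//; last by rewrite gradN// oppr_eq0.
  by rewrite /norm_p_laplacian norm_inf_laplacianN// plap_combinationN ?opprK.
rewrite lerN2 (le_trans _ (s2 _))//; last by rewrite gradN// g0 oppr0.
rewrite hessN// -{1}(opprK (hess phi x)) min_eigenvalueN.
by rewrite -{2}[max_eigenvalue _]opprK plap_combinationN// opprK.
Qed.

End Negation.

(** * Second-order Taylor bound *)

Section Taylor.
Context {R : realType}.

Lemma is_derive_affine (s0 t a b : R) :
  is_derive t (1 : R) (fun z : R => a + b * (z - s0)) b.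
Proof.
have H : is_derive t (1 : R) (fun z : R => z - s0) 1.
  exact: (is_derive_shift t 1 (- s0)).
have H1 := is_deriveD (is_derive_cst a t (1 : R)) (is_deriveZ b H).
by apply: (@is_derive_eq _ _ _ _ _ _ _ _ H1); rewrite add0r [LHS]mulr1.
Qed.

Lemma is_derive_quadratic (s0 t c0 a b : R) : is_derive t (1 : R)
  (fun z : R => c0 + a * (z - s0) + b / 2 * (z - s0) ^+ 2) (a + b * (t - s0)).
Proof.
have H : is_derive t (1 : R) (fun z : R => z - s0) 1.
  exact: (is_derive_shift t 1 (- s0)).
have -> : (fun z : R => c0 + a * (z - s0) + b / 2 * (z - s0) ^+ 2) =
   (fun z => c0 + a * (z - s0)) +
   (b / 2) *: ((fun z : R => z - s0) * (fun z : R => z - s0)).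
  by apply/funext => z; rewrite !fctE expr2.
have H1 := is_deriveD (is_derive_affine s0 t c0 a) (is_deriveZ (b / 2) (is_deriveM H H)).
by apply: (@is_derive_eq _ _ _ _ _ _ _ _ H1); rewrite /GRing.scale /=; field.
Qed.

(** A second derivative is assumed only at [s0], so there is no Lagrange remainder. Instead, the
    slack [eps] makes the derivative of parabola minus [h] have the sign of s - s0, and the mean
    value theorem makes this difference nonnegative on both sides. *)
Lemma taylor2_upper (h h1 : R -> R) (s0 h2 eps : R) : 0 < eps ->
  (\forall s \near s0, is_derive s (1 : R) h (h1 s)) ->
  is_derive s0 (1 : R) h1 h2 ->
  \forall s \near s0, h s <= h s0 + h1 s0 * (s - s0) + (h2 + eps) / 2 * (s - s0) ^+ 2.
Proof.
move=> eps0 dh [dh1 h1E].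
have h1_lin : \forall s \near s0,
    `|h1 s - h1 s0 - h2 * (s - s0)| <= eps * `|s - s0|.
  have : (fun t : R => t^-1 *: (h1 (t *: 1 + s0) - h1 s0)) @ 0^' --> h2.
    by rewrite -h1E; exact: dh1.
  move=> /cvgrPdist_le/(_ _ eps0)/nbhs_ballP[r /= r0 near_r].
  apply/nbhs_ballP; exists r => //= s.
  rewrite -ball_normE /ball_ /= => sr.
  have [->|ss0] := eqVneq s s0; first by rewrite !subrr mulr0 subr0 normr0 mulr0.
  have s0n : s - s0 != 0 by rewrite subr_eq0.
  have := near_r (s - s0); rewrite -ball_normE /ball_ /= sub0r normrN distrC.
  move=> /(_ sr s0n); rewrite [_ *: 1]mulr1 subrK => H.
  have -> : h1 s - h1 s0 - h2 * (s - s0) =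
      - ((h2 - (s - s0)^-1 *: (h1 s - h1 s0)) * (s - s0)).
    by rewrite /GRing.scale /=; field.
  by rewrite normrN normrM (distrC s0) ler_wpM2r.
have : \forall s \near s0, is_derive s (1 : R) h (h1 s) /\
    `|h1 s - h1 s0 - h2 * (s - s0)| <= eps * `|s - s0|.
  exact: (filterI dh h1_lin).
move=> /nbhs_ballP[r /= r0 near_r].
apply/nbhs_ballP; exists r => //= s sr.
(* The nonnegative product says that [c] lies between [s0] and [s], in either order. *)
have seg c : (c - s0) * (s - c) >= 0 -> ball s0 r c.
  move: sr; rewrite -!ball_normE /ball_ /= => sr H.
  rewrite (le_lt_trans _ sr)//.
  rewrite -ler_sqr ?nnegrE// !real_normK ?num_real// -subr_ge0.
  have -> : (s0 - s) ^+ 2 - (s0 - c) ^+ 2 = (s - c) ^+ 2 + 2 * ((c - s0) * (s - c)).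
    by ring.
  by rewrite addr_ge0 ?sqr_ge0// mulr_ge0.
pose g (t : R) := (0 + h1 s0 * (t - s0) + (h2 + eps) / 2 * (t - s0) ^+ 2)
  - (h t - h s0).
pose dg (t : R) := h1 s0 + (h2 + eps) * (t - s0) - h1 t.
have gdg t : ball s0 r t -> is_derive t (1 : R) g (dg t).
  move=> tr; have [dht _] := near_r t tr.
  have dc := is_deriveB dht (is_derive_cst (h s0) t (1 : R)).
  rewrite subr0 in dc.
  exact: (is_deriveB (is_derive_quadratic s0 t 0 (h1 s0) (h2 + eps)) dc).
have dgs t : ball s0 r t -> 0 <= dg t * (t - s0).
  move=> tr; have [_] := near_r t tr.
  rewrite /dg; set d := t - s0; move=> H.
  have H1 := le_trans (ler_norm _) H.
  have H2 : - (h1 t - h1 s0 - h2 * d) <= eps * `|d|.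
    by apply: le_trans H; rewrite -normrN ler_norm.
  case: (lerP 0 d) => d0; [rewrite ger0_norm// in H1 H2|rewrite ltr0_norm// in H1 H2]; nra.
suff : 0 <= g s by rewrite /g; lra.
have g0 : g s0 = 0 by rewrite /g !subrr expr0n /=; ring.
have cont a b : (forall t, t \in `[a, b] -> ball s0 r t) ->
    {within `[a, b], continuous g}.
  move=> H; apply: derivable_within_continuous => t /H tr.
  by have [] := gdg t tr.
case: (ltgtP s0 s) => [s0s|ss0|<-]; last by rewrite g0.
- have Hb t : t \in `[s0, s] -> ball s0 r t.
    by rewrite in_itv /= => /andP[? ?]; apply: seg; rewrite mulr_ge0// subr_ge0.
  have Hb' t : t \in `]s0, s[ -> ball s0 r t.
    by move=> /subset_itv_oo_cc; exact: Hb.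
  have [c cs] := @MVT R g dg s0 s s0s (fun t ht => gdg t (Hb' t ht)) (cont _ _ Hb).
  rewrite g0 subr0 => ->; have := dgs c (Hb' c cs).
  move: cs; rewrite in_itv /= => /andP[c1 _].
  by rewrite pmulr_lge0 ?subr_gt0// => ?; rewrite mulr_ge0// subr_ge0 ltW.
- have Hb t : t \in `[s, s0] -> ball s0 r t.
    rewrite in_itv /= => /andP[? ?]; apply: seg.
    by rewrite mulr_le0// subr_le0.
  have Hb' t : t \in `]s, s0[ -> ball s0 r t.
    by move=> /subset_itv_oo_cc; exact: Hb.
  have [c cs] := @MVT R g dg s s0 ss0 (fun t ht => gdg t (Hb' t ht)) (cont _ _ Hb).
  rewrite g0 sub0r => /eqP; rewrite eqr_oppLR => /eqP ->.
  have := dgs c (Hb' c cs).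
  move: cs; rewrite in_itv /= => /andP[_ c1].
  rewrite nmulr_lge0 ?subr_lt0// => ?.
  by rewrite oppr_ge0 mulr_le0_ge0// subr_ge0 ltW.
Qed.

End Taylor.

(** * Comparison with radial barriers *)

Section Barrier.
Context {R : realType}.
Implicit Types (A B b s : R).

(** The function A r^gamma - (B/2) r^2 in the variable s = r^2, so [b] is gamma/2. *)
Definition barrier A B b s : R := A * s `^ b - B / 2 * s.
Definition barrier_slope A B b s : R := A * b * s `^ (b - 1) - B / 2.

Lemma is_derive_barrier A B b s : 0 < s ->
  is_derive s (1 : R) (barrier A B b) (barrier_slope A B b s).
Proof.
move=> s0; have H := is_derive1_powR b s0.
have -> : barrier A B b = A *: (fun z : R => z `^ b) - (B / 2) *: id.
  by apply/funext => z; rewrite /barrier !fctE.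
have H1 := is_deriveB (is_deriveZ A H) (is_deriveZ (B / 2) (is_derive_id s (1 : R))).
apply: (@is_derive_eq _ _ _ _ _ _ _ _ H1).
by rewrite /barrier_slope /GRing.scale /=; ring.
Qed.

Lemma is_derive_barrier_slope A B b s : 0 < s ->
  is_derive s (1 : R) (barrier_slope A B b) (A * b * (b - 1) * s `^ (b - 2)).
Proof.
move=> s0; have H := is_derive1_powR (b - 1) s0.
have -> : barrier_slope A B b = (A * b) *: (fun z : R => z `^ (b - 1)) - cst (B / 2).
  by apply/funext => z; rewrite /barrier_slope !fctE.
have H1 := is_deriveB (is_deriveZ (A * b) H) (is_derive_cst (B / 2) s (1 : R)).
apply: (@is_derive_eq _ _ _ _ _ _ _ _ H1).
by rewrite /GRing.scale /= (_ : b - 1 - 1 = b - 2); ring.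
Qed.

(** The lower bound is free of [b], so positivity of the barrier slope can be arranged uniformly in
    p. *)
Lemma powR_inv_lower E b s : 1 <= E -> 0 < s <= E -> 0 <= b <= 1 ->
  E^-1 <= s `^ (b - 1).
Proof.
move=> E1 /andP[s0 sE] /andP[b0 b1].
have E0 : 0 < E by rewrite (lt_le_trans _ E1).
rewrite -opprB powRN lef_pV2 ?posrE ?powR_gt0//.
apply: (@le_trans _ _ (E `^ (1 - b))).
  by rewrite ge0_ler_powR ?nnegrE ?subr_ge0// ltW.
by rewrite ler1_powR// lerBlDr lerDl.
Qed.

Lemma powR_mulB1 b s : 0 < s -> s * s `^ (b - 2) = s `^ (b - 1).
Proof.
move=> s0; rewrite -{1}(powRr1 (ltW s0)) -powRD ?(gt_eqF s0) ?implybT//.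
by congr (_ `^ _); ring.
Qed.

End Barrier.

Lemma within_continuousB {R : realType} {T : topologicalType} (K : set T)
    (f g : T -> R) : {within K, continuous f} -> {within K, continuous g} ->
  {within K, continuous (fun x => f x - g x)}.
Proof.
move=> cf cg x.
exact: (@continuousB R R (subspace K) f g x (cf x) (cg x)).
Qed.

Section Comparison.
Context {R : realType} {n : nat}.
Implicit Types (x y : 'rV[R]_n).

Lemma powR_sqdist_continuous (b : R) y : 0 < b ->
  continuous (fun x : 'rV[R]_n => dot (x - y) (x - y) `^ b).
Proof.
move=> b0 x.
(* At x = y the profile has to be continuous on a full neighbourhood of 0, negative arguments
   included; the absolute value provides this. *)
have -> : (fun x : 'rV[R]_n => dot (x - y) (x - y) `^ b) =
    (fun x => (fun s : R => `|s| `^ b) (dot (x - y) (x - y))).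
  by apply/funext => z; rewrite ger0_norm ?dot_ge0.
apply: (@comp_sqdist_continuous R n (fun s : R => `|s| `^ b)).
have [->|xy] := eqVneq x y; last first.
  have s0 : 0 < dot (x - y) (x - y) by rewrite dot_gt0 subr_eq0.
  apply: (@continuous_comp _ _ _ (fun s : R => `|s|) (fun s : R => s `^ b)).
    exact: norm_continuous.
  rewrite ger0_norm ?dot_ge0//.
  apply/differentiable_continuous/derivable1_diffP.
  by have [] := is_derive1_powR b s0.
rewrite subrr dot0l; apply/cvgrPdist_lt => e e0.
have eb : 0 < e `^ b^-1 by rewrite powR_gt0.
apply/nbhs_ballP; exists (e `^ b^-1) => //= s.
rewrite /ball_ /= sub0r normrN => hs.
rewrite normr0 powR0 ?gt_eqF// sub0r normrN ger0_norm ?powR_ge0//.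
have := gt0_ltr_powR b0 _ _ hs; rewrite -powRrM mulVf ?gt_eqF// powRr1 ?(ltW e0)//.
by apply; rewrite nnegrE// ltW.
Qed.

Lemma barrier_sqdist_continuous (A B b : R) y : 0 < b ->
  continuous (fun x : 'rV[R]_n => barrier A B b (dot (x - y) (x - y))).
Proof.
move=> b0 x; rewrite /barrier.
apply: (@continuousB _ _ _ (fun x : 'rV[R]_n => A * dot (x - y) (x - y) `^ b)
  (fun x : 'rV[R]_n => B / 2 * dot (x - y) (x - y))); apply: continuousM.
- exact: cst_continuous.
- exact: powR_sqdist_continuous.
- exact: cst_continuous.
- exact: dotB_continuous.
Qed.

Lemma closure_bound (Omega : set 'rV[R]_n) : bounded_set Omega ->
  exists2 r : R, 1 <= r & forall x, closure Omega x -> `|x| <= r.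
Proof.
move=> /ex_strict_bound_gt0[r r0 rO]; exists (r + 1); first by rewrite lerDr ltW.
move=> x clx; have [z [Oz]] := clx _ (nbhsx_ballx x 1 ltr01).
rewrite -ball_normE /ball_ /= => xz.
rewrite -[x](subrK z) (le_trans (ler_normD _ _))// addrC lerD// ltW//.
exact: rO.
Qed.

Lemma compact_closure (Omega : set 'rV[R]_n) :
  bounded_set Omega -> compact (closure Omega).
Proof.
move=> /closure_bound[r _ rO].
apply: bounded_closed_compact; last exact: closed_closure.
exists r; split; first exact: num_real.
by move=> M rM x /rO xr; apply: le_trans xr (ltW rM).
Qed.

(** The information that the barriers exploit, their slope being positive off the pole. The constant
    [M] in place of f lets u and -u share the same estimates. *)
Definition gradient_subsolution (q : R) (Omega : set 'rV[R]_n) (M : R) v :=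
  forall x0 phi, Omega x0 -> C2 Omega phi -> local_max_at Omega (v \- phi) x0 ->
    grad phi x0 != 0 -> - norm_p_laplacian q%:E phi x0 <= M.

(* A radial function whose normalized p-Laplacian is below [- M] cannot touch
   from above: its quadratic Taylor polynomial in |x - y|^2, with a slightly
   increased second derivative, is an admissible test function. *)
Lemma no_radial_touching (q : R) Omega M v y x0 (h h1 : R -> R) (h2 : R) :
  1 < q -> gradient_subsolution q Omega M v -> Omega x0 -> x0 != y ->
  let s0 := dot (x0 - y) (x0 - y) in
  (\forall s \near s0, is_derive s (1 : R) h (h1 s)) ->
  is_derive s0 (1 : R) h1 h2 -> h1 s0 != 0 ->
  4 * h2 * s0 * (q - 1) + 2 * h1 s0 * (n%:R + q - 2) < - (M * q) ->
  (forall x, Omega x -> v x - h (dot (x - y) (x - y)) <= v x0 - h s0) -> False.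
Proof.
move=> q1 vsub Ox0 x0y s0 dh dh1 h10 op vmax.
have q0 : 0 < q by rewrite (lt_trans _ q1).
have s0_gt0 : 0 < s0 by rewrite dot_gt0 subr_eq0.
set L := 4 * h2 * s0 * (q - 1) + _ in op.
(* [L] is q times the normalized q-Laplacian of the radial function. Raising [h2] by [eps] adds 4 s0
   (q - 1) eps to it, which is half of the slack in [op]. *)
pose eps := (- (M * q) - L) / (8 * s0 * (q - 1)).
have eps0 : 0 < eps by rewrite divr_gt0 ?subr_gt0// !mulr_gt0 ?subr_gt0.
pose c := h2 + eps.
pose P s := h s0 + h1 s0 * (s - s0) + c / 2 * (s - s0) ^+ 2.
pose P1 s := h1 s0 + c * (s - s0).
have dP (s : R) : is_derive s (1 : R) P (P1 s) by exact: is_derive_quadratic.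
have dP1 (s : R) : is_derive s (1 : R) P1 ((fun=> c) s) by exact: is_derive_affine.
have P1s0 : P1 s0 = h1 s0 by rewrite /P1 subrr mulr0 addr0.
have P1s0' : P1 s0 != 0 by rewrite P1s0.
have cc : continuous (fun _ : R => c) by move=> t; exact: cst_continuous.
have cphi : C2 Omega (radial P y) by exact: (C2_radial dP dP1 cc).
have := vsub x0 _ Ox0 cphi.
have lm : local_max_at Omega (v \- radial P y) x0.
  have T : \forall s \near s0, h s <= P s := taylor2_upper eps0 dh dh1.
  have : \forall x \near x0, h (dot (x - y) (x - y)) <= P (dot (x - y) (x - y)).
    exact: (@dotB_continuous _ _ y x0 _ T).
  rewrite /local_max_at; apply: filterS => x hP Ox.
  rewrite /= /radial -/s0 {2}/P subrr expr0n /= !mulr0 !addr0.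
  by apply: le_trans (vmax x Ox); rewrite lerB.
move=> /(_ lm).
rewrite (grad_radial dP) scaler_eq0 subr_eq0 (negPf x0y) orbF.
rewrite mulf_neq0 ?pnatr_eq0// => /(_ isT).
rewrite /norm_p_laplacian /plap_combination (laplacian_radial dP (P2 := fun=> c) dP1).
rewrite (norm_inf_laplacian_radial dP (P2 := fun=> c) dP1 P1s0' x0y) -/s0 P1s0.
apply/negP; rewrite -ltNge -(ltr_pM2r q0).
have -> : - (q^-1 * (4 * c * s0 + n%:R * (2 * h1 s0)) +
   (q - 2) / q * (4 * c * s0 + 2 * h1 s0)) * q =
   - L - 4 * s0 * (q - 1) * eps.
  by rewrite /L /c /=; field; rewrite gt_eqF.
have -> : 4 * s0 * (q - 1) * eps = (- (M * q) - L) / 2.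
  by rewrite /eps; field; rewrite subr_eq0 !gt_eqF.
lra.
Qed.

(* The exponent [b = (q - n) / (2 (q - 1))] makes s^b, s = |x - y|^2, radially
   q-harmonic away from [y]. *)
Lemma barrier_operator (q A B b s : R) : 1 < q -> 0 < s ->
  b = (q - n%:R) / (2 * (q - 1)) ->
  4 * (A * b * (b - 1) * s `^ (b - 2)) * s * (q - 1)
    + 2 * barrier_slope A B b s * (n%:R + q - 2) = - (B * (n%:R + q - 2)).
Proof.
move=> q1 s0 bE; rewrite /barrier_slope -(powR_mulB1 b s0).
have q10 : q - 1 != 0 by rewrite subr_eq0 gt_eqF.
have : 4 * (b - 1) * (q - 1) + 2 * (n%:R + q - 2) = 0.
  by rewrite bE; field.
set T := s `^ (b - 2); move=> E.
transitivity (A * b * s * T * (4 * (b - 1) * (q - 1) + 2 * (n%:R + q - 2))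
  - B * (n%:R + q - 2)); first by field.
by rewrite E mulr0 sub0r.
Qed.

(** A maximum of v minus the barrier at an interior point other than [y] would be a touching by a
    strict supersolution. It is thus attained on the boundary or at the pole, where the bound is
    assumed. The condition [B * D ^+ 2 < 2 * A * b] makes the slope positive up to distance [D]. *)
Lemma barrier_comparison (q : R) Omega M v y (A B b C D : R) :
  (2 <= n)%N -> n%:R < q -> open Omega -> bounded_set Omega ->
  gradient_subsolution q Omega M v -> {within closure Omega, continuous v} ->
  b = (q - n%:R) / (2 * (q - 1)) ->
  0 < B -> M < B -> 1 <= D -> B * D ^+ 2 < 2 * A * b ->
  (forall x, closure Omega x -> dot (x - y) (x - y) <= D ^+ 2) ->
  (forall x, boundary Omega x -> v x <= C + barrier A B b (dot (x - y) (x - y))) ->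
  (Omega y -> v y <= C) ->
  forall x, closure Omega x -> v x <= C + barrier A B b (dot (x - y) (x - y)).
Proof.
move=> n2 nq oO bO vsub cv bE B0 MB D1 AbD dD vbd vy x Kx.
have n2R : 2 <= n%:R :> R by rewrite ler_nat.
have q2 : 2 < q by rewrite (le_lt_trans n2R).
have q1 : 1 < q by lra.
have b0 : 0 < b by rewrite bE divr_gt0 ?subr_gt0// mulr_gt0// subr_gt0.
have b1 : b <= 1 by rewrite bE ler_pdivrMr ?mulr_gt0 ?subr_gt0//; lra.
pose w z := v z - barrier A B b (dot (z - y) (z - y)).
have cw : {within closure Omega, continuous w}.
  apply: within_continuousB cv _; apply: continuous_subspaceT.
  exact: barrier_sqdist_continuous.
have cK := compact_closure bO.
have [x0 /set_mem Kx0 wmax] : exists2 x0, x0 \in closure Omega &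
    forall z, z \in closure Omega -> w z <= w x0.
  by apply: EVT_max_rV => //; exists x.
rewrite -lerBlDr; apply: le_trans (wmax x (mem_set Kx)) _.
have [Ox0|nOx0] := pselect (Omega x0); last first.
  by rewrite lerBlDr; apply: vbd; split=> // /interior_subset.
have [x0y|x0y] := eqVneq x0 y.
  rewrite /w x0y subrr /barrier dot0l powR0 ?gt_eqF// !mulr0 !subr0.
  by apply: vy; rewrite -x0y.
have s0 : 0 < dot (x0 - y) (x0 - y) by rewrite dot_gt0 subr_eq0.
exfalso; apply: (@no_radial_touching q Omega M v y x0 (barrier A B b)
  (barrier_slope A B b) _ q1 vsub Ox0 x0y _ (is_derive_barrier_slope A B b s0)).
- have : \forall s \near dot (x0 - y) (x0 - y), 0 < s.
    exact: (@lt_nbhsr _ _ _ s0).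
  by apply: filterS => s; exact: is_derive_barrier.
- rewrite gt_eqF// /barrier_slope subr_gt0.
  have D2 : 0 < D ^+ 2 by rewrite exprn_gt0// (lt_le_trans _ D1).
  have Ab0 : 0 < A * b.
    by rewrite -(@pmulr_rgt0 _ 2)// mulrA (lt_trans _ AbD)// mulr_gt0.
  have P := @powR_inv_lower R (D ^+ 2) b (dot (x0 - y) (x0 - y)) .
  apply: lt_le_trans (ler_wpM2l (ltW Ab0) (P _ _ _)).
  + by rewrite ltr_pdivlMr//; lra.
  + by rewrite exprn_ege1.
  + by rewrite s0 dD.
  + by rewrite ltW.
(* Strictness: n >= 2 gives B (n + q - 2) >= B q > M q. *)
- rewrite barrier_operator// ltrN2.
  apply: (@lt_le_trans _ _ (B * q)); first by rewrite ltr_pM2r//; lra.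
  by rewrite ler_pM2l//; lra.
- by move=> z Oz; apply: wmax; apply/mem_set; exact: subset_closure.
Qed.

End Comparison.

(** * A priori estimates *)

Section Estimates.
Context {R : realType}.

Lemma powR_sqr (b r : R) : 0 <= r -> (r ^+ 2) `^ b = r `^ (2 * b).
Proof. by move=> r0; rewrite powRrM powR_mulrn. Qed.

Lemma le_powR_scaled (D c r : R) : 1 <= D -> 0 <= c <= 1 -> 0 <= r <= D ->
  r <= D * r `^ c.
Proof.
move=> D1 /andP[c0 c1] /andP[]; rewrite le_eqVlt => /predU1P[<-|r0 rD].
  by move=> _; rewrite mulr_ge0 ?powR_ge0// (le_trans _ D1).
have {1}-> : r = r `^ (1 - c) * r `^ c.
  by rewrite -powRD ?(gt_eqF r0) ?implybT// subrK powRr1// ltW.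
rewrite ler_wpM2r ?powR_ge0//.
apply: (@le_trans _ _ (D `^ (1 - c))).
  by rewrite ge0_ler_powR ?nnegrE ?subr_ge0 ?(ltW r0)// (le_trans _ D1).
by rewrite ler1_powR// lerBlDr lerDl.
Qed.

(** Places Lipschitz boundary data under the barrier: since r <= D r^(2b) on [0, D], the term A
    r^(2b) pays both for the cone L r and for the subtracted quadratic. *)
Lemma barrier_ge_linear (A B b D L r : R) : 1 <= D -> 0 <= L -> 0 <= B ->
  0 <= b <= 2^-1 -> 0 <= r <= D -> L * D + B * D ^+ 2 <= A ->
  L * r <= barrier A B b (r ^+ 2).
Proof.
move=> D1 L0 B0 /andP[b0 b1] /andP[r0 rD] hA; rewrite /barrier powR_sqr//.
have H : r <= D * r `^ (2 * b) by apply: le_powR_scaled; lra.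
set p := r `^ (2 * b) in H *; have p0 : 0 <= p by exact: powR_ge0.
have H1 := ler_wpM2r p0 hA.
have H2 := ler_wpM2l L0 H.
have H3 : r ^+ 2 <= D ^+ 2 * p.
  by rewrite expr2 (le_trans (ler_pM r0 r0 rD H))// mulrA -expr2.
have H4 := ler_wpM2l B0 H3.
have H5 : 0 <= B * r ^+ 2 by rewrite mulr_ge0// sqr_ge0.
lra.
Qed.

Lemma barrier_le_powR (A B b r : R) : 0 <= B -> 0 <= r ->
  barrier A B b (r ^+ 2) <= A * r `^ (2 * b).
Proof.
move=> B0 r0; rewrite /barrier powR_sqr// lerBlDr lerDl.
by rewrite mulr_ge0 ?divr_ge0 ?sqr_ge0.
Qed.

Context {n : nat} (q M e D L G b : R) (Omega : set 'rV[R]_n).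
(** [B > M] gives strictness. In [A], the summand [L * D] absorbs the Lipschitz data, and
    [2 * B * D ^+ 2 + 1] yields [gap] once b >= 1/4. Neither constant involves [q]. *)
Let B := M + 1.
Let A := L * D + 2 * B * D ^+ 2 + 1.
Hypothesis (n2 : (2 <= n)%N) (nq : n%:R < q) (oO : open Omega).
Hypothesis (bO : bounded_set Omega) (bE : b = (q - n%:R) / (2 * (q - 1))).
Hypothesis (b4 : 4^-1 <= b) (M0 : 0 <= M) (e0 : 0 <= e) (L0 : 0 <= L) (D1 : 1 <= D).
Hypothesis dD : forall x y : 'rV[R]_n,
  closure Omega x -> closure Omega y -> enorm (x - y) <= D.
Implicit Types (v g : 'rV[R]_n -> R).

Let b2 : b <= 2^-1.
Proof.
have n2R : 2 <= n%:R :> R by rewrite ler_nat.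
have q1 : 0 < 2 * (q - 1) by move: nq; lra.
by rewrite bE ler_pdivrMr//; move: nq; lra.
Qed.

Let B0 : 0 < B. Proof. by rewrite ltr_wpDl. Qed.

Let BD0 : 0 < B * D ^+ 2.
Proof. by rewrite mulr_gt0// exprn_gt0// (lt_le_trans _ D1). Qed.

Let LD0 : 0 <= L * D.
Proof. by rewrite mulr_ge0// (le_trans _ D1). Qed.

Let A0 : 0 < A.
Proof. by rewrite /A -mulrA; move: BD0 LD0; lra. Qed.

Let hA : L * D + B * D ^+ 2 <= A.
Proof. by rewrite /A -mulrA; move: BD0 LD0; lra. Qed.

Let gap : B * D ^+ 2 < 2 * A * b.
Proof.
have : A * 4^-1 <= A * b by rewrite ler_pM2l.
by rewrite /A -mulrA; move: BD0 LD0; lra.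
Qed.

Let dist_sq (x y : 'rV[R]_n) : dot (x - y) (x - y) = enorm (x - y) ^+ 2.
Proof. by rewrite sqr_enorm. Qed.

Let compare v y C :
  gradient_subsolution q Omega M v -> {within closure Omega, continuous v} ->
  (forall x, closure Omega x -> enorm (x - y) <= D) ->
  (forall x, boundary Omega x -> v x <= C + barrier A B b (enorm (x - y) ^+ 2)) ->
  (Omega y -> v y <= C) ->
  forall x, closure Omega x -> v x <= C + barrier A B b (enorm (x - y) ^+ 2).
Proof.
move=> vsub cv yD vbd vy x Kx.
have := @barrier_comparison R n q Omega M v y A B b C D n2 nq oO bO vsub cv bE B0 _ D1 gap.
move=> /(_ _ _ _ vy x Kx) H.
apply: le_trans (H _ _ _) _.
- by rewrite /B ltrDl.
- by move=> z Kz; rewrite dist_sq ler_pXn2r ?nnegrE ?enorm_ge0 ?yD// (le_trans _ D1).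
- by move=> z bz; rewrite dist_sq; exact: vbd.
- by rewrite dist_sq.
Qed.

Let boundary_closure x : boundary Omega x -> closure Omega x.
Proof. by case. Qed.

Let closure_cases x : closure Omega x -> Omega x \/ boundary Omega x.
Proof.
move=> Kx; have [Ox|nOx] := pselect (Omega x); first by left.
by right; split=> // /interior_subset.
Qed.

Let linear_barrier (x y : 'rV[R]_n) : enorm (x - y) <= D ->
  L * enorm (x - y) <= barrier A B b (enorm (x - y) ^+ 2).
Proof.
move=> xyD; apply: (@barrier_ge_linear A B b D L) => //.
- exact: ltW.
- by rewrite b2 andbT (le_trans _ b4).
- by rewrite enorm_ge0.
Qed.

Lemma boundary_estimate v g : gradient_subsolution q Omega M v ->
  {within closure Omega, continuous v} ->
  (forall x, boundary Omega x -> v x <= g x + e) ->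
  (forall x y, boundary Omega x -> boundary Omega y ->
    g x - g y <= L * enorm (x - y)) ->
  forall x z, closure Omega x -> boundary Omega z ->
    v x <= g z + e + barrier A B b (enorm (x - z) ^+ 2).
Proof.
move=> vsub cv vg gL x z Kx bz; apply: compare => //.
- by move=> w Kw; apply: dD => //; exact: boundary_closure.
- move=> w bw; apply: le_trans (vg w bw) _.
  have wzD : enorm (w - z) <= D by apply: dD; exact: boundary_closure.
  have := gL w z bw bz; have := linear_barrier wzD; lra.
- by case: bz => _ nz Oz; exfalso; apply: nz; exact: open_nbhs_nbhs.
Qed.

(** For [y] on the boundary this is the boundary estimate. For [y] inside, the boundary hypothesis
    of the comparison with pole [y] comes from the boundary estimate for -v with pole [w], evaluated
    at [y]: the barrier is symmetric in its two points. Passing from v to g and back costs [e]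
    twice. *)
Lemma global_estimate v g :
  gradient_subsolution q Omega M v -> gradient_subsolution q Omega M (- v) ->
  {within closure Omega, continuous v} ->
  (forall x, boundary Omega x -> `|v x - g x| <= e) ->
  (forall x y, boundary Omega x -> boundary Omega y ->
    `|g x - g y| <= L * enorm (x - y)) ->
  forall x y, closure Omega x -> closure Omega y ->
    v x <= v y + 2 * e + A * enorm (x - y) `^ (2 * b).
Proof.
move=> vsub vsub' cv vg gL x y Kx Ky.
have vg' z : boundary Omega z -> v z <= g z + e.
  by move=> /vg; rewrite ler_norml => /andP[_]; lra.
have vg'' z : boundary Omega z -> (- v) z <= (- g) z + e.
  by move=> /vg; rewrite ler_norml !fctE => /andP[+ _]; lra.
have gL' w z : boundary Omega w -> boundary Omega z -> g w - g z <= L * enorm (w - z).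
  by move=> bw bz; apply: le_trans (gL w z bw bz); exact: ler_norm.
have gL'' w z : boundary Omega w -> boundary Omega z ->
    (- g) w - (- g) z <= L * enorm (w - z).
  move=> bw bz; apply: le_trans (gL w z bw bz).
  by rewrite !fctE -opprD -normrN ler_norm.
have cv' : {within closure Omega, continuous (- v)}.
  by move=> w; apply: continuousN; exact: cv.
suff H : v x <= v y + 2 * e + barrier A B b (enorm (x - y) ^+ 2).
  by rewrite (le_trans H)// lerD2l barrier_le_powR ?enorm_ge0// ltW.
case: (closure_cases Ky) => [Oy|By]; last first.
  have := boundary_estimate vsub cv vg' gL' Kx By.
  have := vg y By; rewrite ler_norml => /andP[+ _]; lra.
apply: compare => //; first by move=> w Kw; exact: dD.
  move=> w bw; have := boundary_estimate vsub' cv' vg'' gL'' Ky bw.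
  rewrite !fctE enormB; have := vg' w bw; lra.
by rewrite lerDl mulr_ge0.
Qed.

(** With the pole outside [Omega] the condition at the pole is void, and the constant G + e lies
    under the shifted barrier because the barrier is nonnegative up to distance [D]. *)
Lemma sup_estimate v g y : gradient_subsolution q Omega M v ->
  {within closure Omega, continuous v} -> ~ Omega y ->
  (forall x, closure Omega x -> enorm (x - y) <= D) ->
  (forall x, boundary Omega x -> v x <= g x + e) ->
  (forall x, boundary Omega x -> g x <= G) ->
  forall x, closure Omega x -> v x <= G + e + A * D.
Proof.
move=> vsub cv nOy yD vg gG x Kx.
have H : v x <= G + e + barrier A B b (enorm (x - y) ^+ 2).
  apply: compare => // w bw.
  have := linear_barrier (yD w (boundary_closure bw)).
  have : 0 <= L * enorm (w - y) by rewrite mulr_ge0// enorm_ge0.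
  have := vg w bw; have := gG w bw; lra.
rewrite (le_trans H)// lerD2l.
apply: le_trans (barrier_le_powR A b (ltW B0) (enorm_ge0 _)) _.
have b40 : 0 <= b by rewrite (le_trans _ b4).
rewrite ler_wpM2l ?(ltW A0)//.
apply: (@le_trans _ _ (D `^ (2 * b))).
  rewrite ge0_ler_powR ?nnegrE ?enorm_ge0 ?yD ?mulr_ge0//.
  by rewrite (le_trans _ D1).
by rewrite ler1_powR//; move: b2; lra.
Qed.

End Estimates.

(** * Extraction of a uniformly convergent subsequence *)

Section ArzelaAscoli.
Context {R : realType}.

(** Compactness of [-C, C] gives a cluster point, and along an ultrafilter a cluster point is a
    limit. *)
Lemma ultra_bounded_cvg (U : set_system nat) (w : nat -> R) (C : R) :
  UltraFilter U -> U [set k | `|w k| <= C] ->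
  exists l : R, forall eps, 0 < eps -> U [set k | `|w k - l| < eps].
Proof.
move=> UU UC.
have cK : compact `[- C, C]%classic by exact: segment_compact.
have FF : ProperFilter (w @ U) by exact: fmap_proper_filter.
have wU : (w @ U) `[- C, C]%classic.
  suff : U [set k | `[- C, C]%classic (w k)] by [].
  by apply: filterS UC => k /=; rewrite ler_norml in_itv.
have [l [_ lcl]] := cK (w @ U) FF wU.
exists l => eps eps0.
have [//|Un] := in_ultra_setVsetC [set k | `|w k - l| < eps] UU.
have := lcl (w @` ~` [set k | `|w k - l| < eps]) (ball l eps).
have wn : (w @ U) (w @` ~` [set k | `|w k - l| < eps]).
  suff : U [set k' | (w @` ~` [set k | `|w k - l| < eps]) (w k')] by [].
  by apply: filterS Un => k /= kn; exists k.
move=> /(_ wn (nbhsx_ballx l eps eps0))[_ [[k /= kn <-]]].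
by rewrite -ball_normE /ball_ /= distrC => /kn.
Qed.

Context {T : topologicalType}.

(** One ultrafilter finer than the tails gives limits at all points simultaneously, in place of a
    diagonal extraction over a dense sequence. The modulus is a joint condition on y near x and k
    large, which accommodates estimates with an error vanishing only in k. *)
Lemma arzela_ascoli_subsequence (K : set T) (v : nat -> T -> R) (C : R) :
  compact K ->
  (\forall k \near \oo, forall x, K x -> `|v k x| <= C) ->
  (forall eps, 0 < eps -> forall x, K x ->
    \forall y \near x & k \near \oo, K y -> `|v k y - v k x| <= eps) ->
  exists (s : nat -> nat) (u : T -> R),
    (forall i j, (i < j)%N -> (s i < s j)%N) /\
    forall eps, 0 < eps -> \forall j \near \oo,
      forall x, K x -> `|v (s j) x - u x| <= eps.
Proof.
move=> cK vC mod.
have [U [UU ooU]] := ultraFilterLemma (eventually_filter : ProperFilter \oo).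
have lim_ex x : exists l : R, K x -> forall eps, 0 < eps -> U [set k | `|v k x - l| < eps].
  have [Kx|nKx] := pselect (K x); last by exists 0.
  have [l lP] : exists l : R, forall eps, 0 < eps -> U [set k | `|v k x - l| < eps].
    apply: (@ultra_bounded_cvg U (v ^~ x) C UU).
    by apply: ooU; apply: filterS vC => k /(_ x Kx).
  by exists l.
pose u x := projT1 (cid (lim_ex x)).
have uP x : K x -> forall eps, 0 < eps -> U [set k | `|v k x - u x| < eps].
  by move=> Kx; rewrite /u; case: cid => l /= /(_ Kx).
have unif eps : 0 < eps -> U [set k | forall x, K x -> `|v k x - u x| <= eps].
  move=> eps0; have e4 : 0 < eps / 8 by rewrite divr_gt0.
  (* Compactness as near-covering: a property that holds, around each x, for y near x and [U]-most k
     holds for [U]-most k on all of [K]. *)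
  have /near_covering_withinP cov := (compact_near_coveringP K).1 cK.
  apply: (cov nat U (fun k x => `|v k x - u x| <= eps)) => x Kx.
  have [[Q1 Q2] [/= nQ1 nQ2] Q12] := mod _ e4 x Kx.
  exists (Q1, Q2 `&` [set k | `|v k x - u x| < eps / 8]).
    by split=> //=; apply: filterI; [exact: ooU|exact: uP].
  move=> [y k] [/= Q1y [Q2k vux]] Ky.
  (* The modulus passes to [u] through one index [k'] at which the sequence is close to [u] at both
     points. In total the errors amount to 5 eps / 8. *)
  have uxy : `|u x - u y| <= eps / 8 + eps / 8 + eps / 8.
    have [k' [[Q2k' k'x] k'y]] := @filter_ex _ U _ _
      (filterI (filterI (ooU _ nQ2) (uP x Kx _ e4)) (uP y Ky _ e4)).
    have := Q12 (y, k') (conj Q1y Q2k') Ky.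
    move: k'x k'y; rewrite /= !ler_norml !ltr_norml => /andP[? ?] /andP[? ?] /andP[? ?].
    by apply/andP; split; lra.
  have := Q12 (y, k) (conj Q1y Q2k) Ky.
  move: uxy vux; rewrite /= !ler_norml !ltr_norml => /andP[? ?] /andP[? ?] /andP[? ?].
  by apply/andP; split; lra.
(* [mj] pairs the index to be exceeded with the precision demanded; a set of [U] meets every
   tail. *)
have next_ex (mj : nat * nat) : exists k, (mj.1 < k)%N /\
    forall x, K x -> `|v k x - u x| <= mj.2.+1%:R^-1.
  have j0 : 0 < mj.2.+1%:R^-1 :> R by rewrite invr_gt0.
  have Um : U [set k | (mj.1 < k)%N] by apply: ooU; exists mj.1.+1.
  have [k [? ?]] := @filter_ex _ U _ _ (filterI Um (unif _ j0)).
  by exists k.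
pose next mj := projT1 (cid (next_ex mj)).
pose s := fix s (j : nat) : nat := if j is i.+1 then next (s i, j) else next (0%N, 0%N).
have sE j : forall x, K x -> `|v (s j) x - u x| <= j.+1%:R^-1.
  by case: j => [|j] /=; rewrite /next; case: cid => k [].
exists s, u; split.
  have sS i : (s i < s i.+1)%N by rewrite /= /next; case: cid => k [].
  by move=> i j; apply: (@homo_ltn _ s (fun a b => (a < b)%N)) => //; exact: ltn_trans.
move=> eps eps0.
have [N _ NP] := near_infty_natSinv_lt (PosNum eps0).
exists N => // j Nj x Kx; apply: le_trans (sE j x Kx) (ltW _).
exact: NP.
Qed.

End ArzelaAscoli.

(** * Stability of viscosity subsolutions *)

Lemma within_open_continuous {R : realType} {T : topologicalType} (A : set T)
    (f : T -> R) (x : T) : open A -> {within A, continuous f} -> A x ->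
  {for x, continuous f}.
Proof.
by move=> oA; rewrite continuous_open_subspace// => cf Ax; exact: cf (mem_set Ax).
Qed.

Lemma dist_half_lt {R : realType} (a b c d : R) :
  `|a - b| < d / 2 -> `|c - b| <= d / 2 -> `|a - c| < d.
Proof.
move=> ab cb; apply: le_lt_trans (ler_distD b a c) _.
by rewrite [ltRHS]splitr (distrC b) ltr_leD.
Qed.

Lemma ratio_ge0 {R : realType} (q : R) : 2 < q -> 0 <= (q - 2) / q.
Proof.
by move=> q2; rewrite divr_ge0 ?subr_ge0 ?(ltW q2)// (ltW (lt_trans _ q2)).
Qed.

Section Stability.
Context {R : realType} {n : nat}.
Implicit Types (phi : 'rV[R]_n -> R) (x : 'rV[R]_n).

Lemma gradE phi x i : grad phi x 0 i = partial i phi x.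
Proof. by rewrite mxE. Qed.

Lemma hessE phi x i j : hess phi x i j = partial j (partial i phi) x.
Proof. by rewrite mxE. Qed.

Lemma quad_formE (X : 'M[R]_n) x :
  dot (x *m X) x = \sum_i (\sum_j x 0 j * X j i) * x 0 i.
Proof. by apply: eq_bigr => i _; rewrite mxE. Qed.

Lemma usc_on_continuous (Omega : set 'rV[R]_n) (u : 'rV[R]_n -> R) :
  {within Omega, continuous u} -> usc_on Omega u.
Proof.
move=> /subspace_continuousP cu x Ox a ua.
have H := cu x Ox; exact: (@cvgr_lt R _ _ _ u (u x) H a ua).
Qed.

(* Composed with |x - x0|^2 it gives the penalty |x - x0|^4, whose first and
   second derivatives vanish at [x0]. *)
Let sqr0 (z : R) : R := z ^+ 2.
Let sqr1 (z : R) : R := 0 + 2 * (z - 0).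
Let sqr2 (z : R) : R := 2.

Let d4 (s : R) : is_derive s (1 : R) sqr0 (sqr1 s).
Proof.
have -> : sqr0 = fun z : R => 0 + 0 * (z - 0) + 2 / 2 * (z - 0) ^+ 2.
  by apply/funext => z; rewrite /sqr0; field.
exact: is_derive_quadratic.
Qed.

Let d41 (s : R) : is_derive s (1 : R) sqr1 (sqr2 s).
Proof. exact: is_derive_affine. Qed.

Let c4 : continuous sqr2.
Proof. by move=> t; exact: cst_continuous. Qed.

(** As (p - 2) / p = 1 - 2 / p, the Laplacian term disappears in the limit. [L] is left abstract to
    stand for the infinity Laplacian or for an eigenvalue bound. *)
Lemma plap_limit_le (p lap L F : nat -> R) (lap0 L0 F0 : R) :
  p @ \oo --> +oo -> lap @ \oo --> lap0 -> L @ \oo --> L0 -> F @ \oo --> F0 ->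
  (\forall k \near \oo, - ((p k)^-1 * lap k + (p k - 2) / p k * L k) <= F k) ->
  - L0 <= F0.
Proof.
move=> poo clap cL cF H.
have cV : (fun k => (p k)^-1) @ \oo --> (0 : R).
  exact: (iffRL (gtr0_cvgV0 (cvgry_gt poo 0)) poo).
have c1 : (fun k => (p k)^-1 * lap k) @ \oo --> 0 * lap0 by exact: cvgM.
have c2 : (fun k => (1 - 2 * (p k)^-1) * L k) @ \oo --> (1 - 2 * 0) * L0.
  apply: cvgM cL; apply: cvgB; first exact: cvg_cst.
  by apply: cvgM cV; exact: cvg_cst.
have c3 : (fun k => F k + ((p k)^-1 * lap k + (1 - 2 * (p k)^-1) * L k)) @ \oo -->
    F0 + (0 * lap0 + (1 - 2 * 0) * L0).
  by apply: cvgD cF _; exact: cvgD.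
suff : 0 <= F0 + (0 * lap0 + (1 - 2 * 0) * L0) by rewrite mul0r mulr0 subr0 mul1r; lra.
apply: (cvgr_to_ge c3).
have pgt := cvgry_gt poo 0.
near=> k.
have p0 : 0 < p k by near: k; exact: pgt.
have Hk : - ((p k)^-1 * lap k + (p k - 2) / p k * L k) <= F k by near: k; exact: H.
have <- : (p k - 2) / p k = 1 - 2 * (p k)^-1 by field; rewrite gt_eqF.
lra.
Unshelve. all: by end_near.
Qed.

(** Free of square roots, so that limits follow from those of sums, products and an inverse. *)
Lemma norm_inf_laplacian_quotient phi x :
  norm_inf_laplacian phi x =
  dot (grad phi x *m hess phi x) (grad phi x) / dot (grad phi x) (grad phi x).
Proof.
rewrite /norm_inf_laplacian -scalemxAl dotZl dotZr mulrA -expr2 exprVn sqr_enorm.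
by rewrite mulrC.
Qed.

Lemma norm_inf_laplacian_le phi x : (0 < n)%N ->
  (hess phi x)^T = hess phi x -> grad phi x != 0 ->
  norm_inf_laplacian phi x <= max_eigenvalue (hess phi x).
Proof.
move=> n0 sH g0; rewrite norm_inf_laplacian_quotient.
by rewrite ler_pdivrMr ?dot_gt0// quad_form_le_max_eigenvalue.
Qed.

(** * Differential operators along a convergent sequence of points *)

Section Limits.
Context (Omega : set 'rV[R]_n) (psi : 'rV[R]_n -> R) (z : nat -> 'rV[R]_n) (x0 : 'rV[R]_n).
Hypothesis (Ox0 : Omega x0) (cpsi : C2 Omega psi) (zx0 : z @ \oo --> x0).

Lemma cvg_grad i : (fun k => grad psi (z k) 0 i) @ \oo --> grad psi x0 0 i.
Proof.
have [_ /(_ i)[_ c1] _] := cpsi Ox0.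
under eq_fun do rewrite gradE.
rewrite gradE; exact: cvg_comp zx0 c1.
Qed.

Lemma cvg_hess i j : (fun k => hess psi (z k) i j) @ \oo --> hess psi x0 i j.
Proof.
have [_ _ /(_ i j)[_ c2]] := cpsi Ox0.
under eq_fun do rewrite hessE.
rewrite hessE; exact: cvg_comp zx0 c2.
Qed.

Lemma cvg_laplacian : (fun k => laplacian psi (z k)) @ \oo --> laplacian psi x0.
Proof. by apply: cvg_sumr => i; exact: cvg_hess. Qed.

Lemma cvg_dot_grad : (fun k => dot (grad psi (z k)) (grad psi (z k))) @ \oo -->
  dot (grad psi x0) (grad psi x0).
Proof. by apply: cvg_sumr => i; apply: cvgM; exact: cvg_grad. Qed.

Lemma cvg_norm_inf_laplacian : grad psi x0 != 0 ->
  (fun k => norm_inf_laplacian psi (z k)) @ \oo --> norm_inf_laplacian psi x0.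
Proof.
move=> g0; under eq_fun do rewrite norm_inf_laplacian_quotient quad_formE.
rewrite norm_inf_laplacian_quotient quad_formE.
have cN : (fun k => (dot (grad psi (z k)) (grad psi (z k)))^-1) @ \oo -->
    (dot (grad psi x0) (grad psi x0))^-1.
  by apply: cvgV cvg_dot_grad; rewrite dot_eq0.
have cQ : (fun k => \sum_i (\sum_j grad psi (z k) 0 j * hess psi (z k) j i) *
      grad psi (z k) 0 i) @ \oo -->
    \sum_i (\sum_j grad psi x0 0 j * hess psi x0 j i) * grad psi x0 0 i.
  apply: cvg_sumr => i.
  apply: (@cvgM _ _ _ _ (fun k => \sum_j grad psi (z k) 0 j * hess psi (z k) j i)
    (fun k => grad psi (z k) 0 i)); last exact: cvg_grad.
  apply: cvg_sumr => j.
  by apply: (@cvgM _ _ _ _ (fun k => grad psi (z k) 0 j)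
    (fun k => hess psi (z k) j i)); [exact: cvg_grad|exact: cvg_hess].
exact: (cvgM cQ cN).
Qed.

Lemma cvg_hess_dist :
  (fun k => \sum_i \sum_j `|hess psi (z k) i j - hess psi x0 i j|) @ \oo --> (0 : R).
Proof.
rewrite -[X in _ --> X](_ : \sum_i \sum_j `|hess psi x0 i j - hess psi x0 i j| = 0).
  2: by rewrite big1// => i _; rewrite big1// => j _; rewrite subrr normr0.
apply: (@cvg_sumr R _ _ \oo _
  (fun i k => \sum_j `|hess psi (z k) i j - hess psi x0 i j|)) => i.
apply: (@cvg_sumr R _ _ \oo _
  (fun j k => `|hess psi (z k) i j - hess psi x0 i j|)) => j.
have c : (fun k => hess psi (z k) i j - hess psi x0 i j) @ \oo -->
    hess psi x0 i j - hess psi x0 i j.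
  by apply: cvgB; [exact: cvg_hess|exact: cvg_cst].
exact: cvg_norm c.
Qed.

End Limits.

Lemma closed_sup_ball_compact x0 (r : R) :
  compact [set x : 'rV[R]_n | `|x - x0| <= r].
Proof.
apply: bounded_closed_compact.
  exists (r + `|x0|); split; first exact: num_real.
  move=> M rM x /= xr; rewrite -[x](subrK x0) (le_trans (ler_normD _ _))//.
  by rewrite (le_trans _ (ltW rM))// lerD2r.
have -> : [set x : 'rV[R]_n | `|x - x0| <= r] =
    (fun x : 'rV[R]_n => `|x - x0|) @^-1` [set t | t <= r] by [].
apply: closed_comp; last exact: closed_le.
move=> x _; apply: (@continuous_comp _ _ _ (fun x : 'rV[R]_n => x - x0) Num.norm).
  by apply: continuousB; [exact: cvg_id|exact: cst_continuous].
exact: norm_continuous.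
Qed.

(** * Penalized touching and the limit of the inequalities *)

Context (Omega : set 'rV[R]_n) (u_ : nat -> 'rV[R]_n -> R) (u : 'rV[R]_n -> R).
Hypothesis (oO : open Omega).
Hypothesis (cu_ : forall k, {within Omega, continuous (u_ k)}).
Hypothesis (u_cvg : forall eps, 0 < eps ->
  \forall k \near \oo, forall x, Omega x -> `|u_ k x - u x| <= eps).

(** The factor 1 gives the sum the shape required by the results on linear combinations. *)
Let penalized phi x0 := 1 *: phi + radial sqr0 x0.

Let C2_penalized phi x0 : C2 Omega phi -> C2 Omega (penalized phi x0).
Proof.
move=> cphi; have H : C2 Omega (radial sqr0 x0) by apply: (C2_radial d4 d41 c4).
exact: (C2_lin 1 oO cphi H).
Qed.

(** The maximum of u - phi at [x0] may fail to be strict. The quartic penalty makes it strict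
    quantitatively, so maximizers of the perturbed functions over a small closed ball converge to
    [x0] and eventually lie in its interior. *)
Lemma penalized_maximizers phi x0 :
  Omega x0 -> C2 Omega phi -> local_max_at Omega (u \- phi) x0 ->
  exists z : nat -> 'rV[R]_n, z @ \oo --> x0 /\
    \forall k \near \oo, Omega (z k) /\
      local_max_at Omega (u_ k \- penalized phi x0) (z k).
Proof.
move=> Ox0 cphi mx.
have cpsi := C2_penalized x0 cphi; set psi := penalized phi x0 in cpsi *.
have psiE x : psi x = phi x + dot (x - x0) (x - x0) ^+ 2.
  by rewrite /psi /penalized !fctE scale1r.
have : \forall y \near x0, Omega y /\ (u \- phi) y <= (u \- phi) x0.
  have oOx0 : \forall y \near x0, Omega y by exact: open_nbhs_nbhs.
  by apply: filterS (filterI oOx0 mx) => y [Oy my]; split=> //; exact: my.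
move=> /nbhs_ballP[r /= r0 ballr].
pose K := [set x : 'rV[R]_n | `|x - x0| <= r / 2].
have r2 : 0 < r / 2 by rewrite divr_gt0.
have Kball x : K x -> Omega x /\ u x - phi x <= u x0 - phi x0.
  move=> Kx; apply: ballr; rewrite -ball_normE /ball_ /= distrC.
  by apply: le_lt_trans Kx _; rewrite ltr_pdivrMr// ltr_pMr// ltr1n.
have KO : K `<=` Omega by move=> x /Kball[].
have Kx0 : K x0 by rewrite /K /= subrr normr0 ltW.
have /choice[z zP] : forall k, exists x, K x /\
    forall y, K y -> u_ k y - psi y <= u_ k x - psi x.
  move=> k.
  have [||x /set_mem Kx xmax] :=
      @EVT_max_rV R n (fun x => u_ k x - psi x) K _ (@closed_sup_ball_compact x0 (r / 2)).
  - by exists x0.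
  - apply: (@within_continuousB _ _ K (u_ k) psi).
      exact: (continuous_subspaceW KO (@cu_ k)).
    apply: (continuous_subspaceW KO); apply: continuous_in_subspaceT => x /set_mem Ox.
    by have [] := cpsi x Ox.
  - by exists x; split=> // y /mem_set; exact: xmax.
have zcvg : z @ \oo --> x0.
  apply/cvgrPdist_lt => e e0.
  (* Comparing the values at [z k] and [x0] gives |z k - x0|^4 <= 2 sup |u_k - u| <= e^4 / 2. *)
  have e4 : 0 < e ^+ 4 / 4 by rewrite divr_gt0// exprn_gt0.
  apply: filterS (u_cvg e4) => k uk.
  have [Kz zmax] := zP k; have [Oz uz] := Kball _ Kz.
  have := zmax _ Kx0; rewrite !psiE subrr dot0l expr0n /=.
  have := uk _ Oz; have := uk _ Ox0.
  rewrite !ler_norml => /andP[h1 _] /andP[_ h2] h3.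
  have h4 : dot (z k - x0) (z k - x0) ^+ 2 < e ^+ 4.
    have : 0 < e ^+ 4 by rewrite exprn_gt0.
    by lra.
  rewrite distrC; apply: le_lt_trans (normr_le_enorm _) _.
  by rewrite -(@ltr_pXn2r _ 4) ?nnegrE ?enorm_ge0 ?(ltW e0)// (exprM _ 2 2) sqr_enorm.
exists z; split=> //.
have : \forall k \near \oo, `|x0 - z k| < r / 2.
  by move/cvgrPdist_lt : zcvg => /(_ _ r2).
apply: filterS => k zk; have [Kz zmax] := zP k; split; first exact: KO.
have : \forall y \near z k, K y.
  apply/nbhs_ballP; exists (r / 2 - `|x0 - z k|); first by rewrite /= subr_gt0.
  move=> y; rewrite -ball_normE /ball_ /= ltrBrDr => h.
  rewrite /K /=; apply: le_trans (ler_distD (z k) y x0) _.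
  by rewrite (distrC y) (distrC (z k) x0) ltW.
by rewrite /local_max_at; apply: filterS => y Ky _; exact: zmax.
Qed.

Lemma stability_subsolution (p : nat -> R) (f_ : nat -> 'rV[R]_n -> R) f :
  (0 < n)%N -> p @ \oo --> +oo ->
  (forall eps, 0 < eps ->
    \forall k \near \oo, forall x, Omega x -> `|f_ k x - f x| <= eps) ->
  {within Omega, continuous f} -> {within Omega, continuous u} ->
  (forall k, viscosity_subsolution (p k)%:E Omega (f_ k) (u_ k)) ->
  viscosity_subsolution +oo%E Omega f u.
Proof.
move=> n0 poo f_cvg cf cu sub; split; first exact: usc_on_continuous.
move=> x0 phi Ox0 cphi mx.
have [z [zx0 zmax]] := penalized_maximizers Ox0 cphi mx.
have cpsi := C2_penalized x0 cphi; set psi := penalized phi x0 in cpsi zmax.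
have H4 : C2 Omega (radial sqr0 x0) by apply: (C2_radial d4 d41 c4).
have gpsi : grad psi x0 = grad phi x0.
  rewrite /psi /penalized (grad_lin 1 cphi H4 Ox0) (grad_radial d4).
  by rewrite subrr scaler0 addr0 scale1r.
have hpsi : hess psi x0 = hess phi x0.
  rewrite /psi /penalized (hess_lin 1 oO cphi H4 Ox0) (hess_radial d4 d41).
  rewrite subrr mulmx0 scaler0 add0r scale1r dot0l /sqr1.
  by rewrite subr0 mulr0 addr0 mulr0 raddf0 addr0.
(* From here [psi] enters only as a C^2 function with the gradient and Hessian of [phi] at [x0] and
   the touching points [z k]. *)
clearbody psi.
have cF : (fun k => f_ k (z k)) @ \oo --> f x0.
  apply/cvgrPdist_lt => e e0.
  have e2 : 0 < e / 2 by rewrite divr_gt0.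
  have cfx0 := within_open_continuous oO cf Ox0.
  have : \forall k \near \oo, `|f x0 - f (z k)| < e / 2.
    have cfz : (fun k => f (z k)) @ \oo --> f x0 by exact: cvg_comp zx0 cfx0.
    by move/cvgrPdist_lt : cfz => /(_ _ e2).
  move=> near1; have near2 := f_cvg _ e2.
  apply: filterS (filterI near1 (filterI near2 zmax)) => k [h1 [h2 [Oz _]]].
  exact: dist_half_lt h1 (h2 _ Oz).
have clap := cvg_laplacian Ox0 cpsi zx0.
have cH := cvg_hess_dist Ox0 cpsi zx0.
have pgt2 : \forall k \near \oo, 2 < p k by exact: (cvgry_gt poo 2).
split=> [g0|g0].
- rewrite /norm_p_laplacian /= /norm_inf_laplacian -gpsi -hpsi -/(norm_inf_laplacian psi x0).
  have g0' : grad psi x0 != 0 by rewrite gpsi.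
  apply: (plap_limit_le poo clap (cvg_norm_inf_laplacian Ox0 cpsi zx0 g0') cF).
  have gn : \forall k \near \oo, grad psi (z k) != 0.
    have gg : 0 < dot (grad psi x0) (grad psi x0) by rewrite dot_gt0.
    have H : \forall k \near \oo, 0 < dot (grad psi (z k)) (grad psi (z k)).
      exact: (@cvgr_gt R _ _ _ _ _ (cvg_dot_grad Ox0 cpsi zx0) 0 gg).
    by apply: filterS H => k; rewrite dot_gt0.
  apply: filterS (filterI gn zmax) => k [gk [Oz mz]].
  by have [_ /(_ _ _ Oz cpsi mz)[/(_ gk)]] := sub k.
- rewrite /= -hpsi.
  (* This majorant of the top eigenvalue at [z k] has an evident limit. It bounds the second-order
     term whether or not the gradient at [z k] vanishes, and (p - 2) / p >= 0 preserves the
     inequality. *)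
  have cL : (fun k => max_eigenvalue (hess psi x0) +
      \sum_i \sum_j `|hess psi (z k) i j - hess psi x0 i j|) @ \oo -->
      max_eigenvalue (hess psi x0) + 0.
    by apply: cvgD cH; exact: cvg_cst.
  rewrite -[max_eigenvalue _]addr0.
  apply: (plap_limit_le poo clap cL cF).
  apply: filterS (filterI pgt2 zmax) => k [p2 [Oz mz]].
  have [_ /(_ _ _ Oz cpsi mz)[s1 s2]] := sub k.
  have sx0 := hess_sym oO cpsi Ox0; have sz := hess_sym oO cpsi Oz.
  have ML := max_eigenvalue_le n0 sz sx0.
  have pk := ratio_ge0 p2.
  have [gz|gz] := eqVneq (grad psi (z k)) 0.
    apply: le_trans (s2 gz); rewrite lerN2 lerD2l.
    exact: (ler_wpM2l pk ML).
  apply: le_trans (s1 gz); rewrite lerN2 lerD2l.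
  exact: (ler_wpM2l pk (le_trans (norm_inf_laplacian_le n0 sz gz) ML)).
Qed.

End Stability.

(** * Uniform convergence, Hölder bounds and exponents *)

Section Uniform.
Context {R : realType} {n : nat}.
Implicit Types (A Omega : set 'rV[R]_n) (g u : 'rV[R]_n -> R).

Lemma uniform_cvg_dist A (F : nat -> 'rV[R]_n -> R) g :
  {uniform A, F @ \oo --> g} <->
  (forall eps, 0 < eps ->
    \forall k \near \oo, forall x, A x -> `|F k x - g x| <= eps).
Proof.
split=> [cF eps eps0|H P].
  have /cF : nbhs (g : {uniform` A -> R})
      [set h | forall y, A y -> `|h y - g y| <= eps].
    apply/uniform_nbhs; exists [set xy : R * R | ball xy.1 eps xy.2]; split.
      exact: (entourage_ball R (PosNum eps0)).
    move=> h /= hg y Ay; have := hg y Ay.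
    by rewrite -ball_normE /ball_ /= distrC => /ltW.
  by [].
move=> /uniform_nbhs[E [entE EP]].
have [eps /= eps0 epsE] : exists2 eps : R, 0 < eps &
    [set xy : R * R | ball xy.1 eps xy.2] `<=` E.
  by move: entE; rewrite -entourage_ballE => -[eps /= e0 eE]; exists eps.
have e2 : 0 < eps / 2 by rewrite divr_gt0.
have := H _ e2; apply: filterS => k Fk; apply: EP => y Ay; apply: epsE => /=.
rewrite -ball_normE /ball_ /= distrC (le_lt_trans (Fk y Ay))//.
by rewrite ltr_pdivrMr// ltr_pMr// ltr1n.
Qed.

(** If [A] has two points, both suprema are bounded below by real numbers, so a finite sum makes
    each of them finite. *)
Lemma holder_bounds A g : holder A 1 g -> exists G L : R,
  [/\ 0 <= L, forall x, A x -> `|g x| <= G &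
    forall x y, A x -> A y -> `|g x - g y| <= L * enorm (x - y)].
Proof.
rewrite /holder /holder_norm.
set S1 := ereal_sup _; set S2 := ereal_sup _ => S12.
have ub1 x : A x -> (`|g x|%:E <= S1)%E.
  by move=> Ax; apply: ereal_sup_ubound; exists x.
have ub2 x y : A x -> A y -> x != y ->
    ((`|g x - g y| / enorm (x - y))%:E <= S2)%E.
  move=> Ax Ay xy; apply: ereal_sup_ubound; exists (x, y) => //=.
  by rewrite powRr1// enorm_ge0.
have [[x [y [Ax Ay xy]]]|same] := pselect (exists x y, [/\ A x, A y & x != y]).
- have := ub1 x Ax; have := ub2 x y Ax Ay xy.
  move: S1 S2 ub1 ub2 S12 => [G| |] [L| |]//= ub1 ub2 _ L0 _.
  have L00 : 0 <= L.
    by rewrite lee_fin in L0; rewrite (le_trans _ L0)// divr_ge0// enorm_ge0.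
  exists G, L; split=> [||z w Az Aw]; [exact: L00|exact: ub1|].
  have [->|zw] := eqVneq z w; first by rewrite !subrr enorm0 mulr0 normr0.
  have := ub2 z w Az Aw zw; rewrite lee_fin ler_pdivrMr//.
  by rewrite enorm_gt0 subr_eq0.
(* With at most one point the second supremum is over the empty set, so it equals -oo and carries no
   constant; the bounds are given directly. *)
- have eqA x y : A x -> A y -> x = y.
    by move=> Ax Ay; apply/eqP/contraT => xy; exfalso; apply: same; exists x, y.
  have [[z Az]|A0] := pselect (exists z, A z).
    exists `|g z|, 0; split=> // [x Ax|x y Ax Ay].
      by rewrite (eqA x z Ax Az).
    by rewrite (eqA x y Ax Ay) !subrr enorm0 mulr0 normr0.
  by exists 0, 0; split=> // x; [move=> Ax|move=> y Ax]; exfalso; apply: A0; exists x.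
Qed.

Lemma lipschitz_holder A (C L : R) u : (forall x, A x -> `|u x| <= C) ->
  (forall x y, A x -> A y -> u x <= u y + L * enorm (x - y)) ->
  holder A 1 u.
Proof.
move=> uC uL; rewrite /holder /holder_norm.
apply: (@le_lt_trans _ _ (C%:E + L%:E)%E); last by rewrite -EFinD ltry.
apply: leeD; apply: ge_ereal_sup => t [].
  by move=> x Ax <-; rewrite lee_fin uC.
move=> [x y] /= [Ax Ay xy] <-; rewrite lee_fin powRr1 ?enorm_ge0//.
rewrite ler_pdivrMr ?enorm_gt0 ?subr_eq0// ler_norml.
have := uL x y Ax Ay; have := uL y x Ay Ax; rewrite (enormB y) => h1 h2.
by apply/andP; split; lra.
Qed.

Lemma enorm_le_coord (v : 'rV[R]_n) (c : R) : (0 < n)%N -> 0 <= c ->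
  (forall i, `|v 0 i| <= c) -> enorm v <= n%:R * c.
Proof.
move=> n0 c0 vc.
rewrite -(@ler_pXn2r _ 2) ?nnegrE ?enorm_ge0 ?mulr_ge0// sqr_enorm.
apply: (@le_trans _ _ (n%:R * c ^+ 2)).
  have -> : n%:R * c ^+ 2 = \sum_(i < n) c ^+ 2.
    by rewrite sumr_const card_ord mulr_natl.
  apply: ler_sum => i _; rewrite -expr2 -[leLHS]real_normK ?num_real//.
  by rewrite ler_pXn2r// ?nnegrE.
rewrite exprMn ler_wpM2r ?sqr_ge0// expr2 ler_peMl// ?ler1n//.
Qed.

(* The pole [y] outside [Omega] serves to bound the solutions without knowing
   that the boundary is nonempty. *)
Lemma diameter_and_pole Omega : (0 < n)%N -> bounded_set Omega ->
  exists D : R, exists y : 'rV[R]_n, [/\ 1 <= D, ~ Omega y,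
    forall x z, closure Omega x -> closure Omega z -> enorm (x - z) <= D &
    forall x, closure Omega x -> enorm (x - y) <= D].
Proof.
move=> n0 /closure_bound[r r1 rO].
have r0 : 0 < r by rewrite (lt_le_trans _ r1).
have coordr x i : closure Omega x -> `|x 0 i| <= r.
  by move=> /rO; apply: le_trans; exact: norm_coord_le.
(* Points of the closure have coordinates in [-r, r], so the pole with coordinates 2r is outside,
   and all coordinate differences are at most 3r. *)
exists (n%:R * (3 * r)), (const_mx (2 * r)); split.
- have : 1 <= n%:R :> R by rewrite ler1n.
  by move=> n1; rewrite -[leLHS]mulr1 ler_pM//; lra.
- move=> /subset_closure /rO; apply/negP; rewrite -ltNge.
  apply: lt_le_trans (norm_coord_le _ (Ordinal n0)).
  by rewrite mxE ger0_norm; lra.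
- move=> x z Kx Kz; apply: enorm_le_coord => // [|i]; first by lra.
  rewrite !mxE (le_trans (ler_normB _ _))//.
  have := coordr x i Kx; have := coordr z i Kz; lra.
- move=> x Kx; apply: enorm_le_coord => // [|i]; first by lra.
  rewrite !mxE (le_trans (ler_normB _ _))// (ger0_norm (x := 2 * r)); last lra.
  have := coordr x i Kx; lra.
Qed.

End Uniform.

(** * Exponents tending to 1, and subsequences *)

Section Exponents.
Context {R : realType}.

Lemma cvg_exponent (m : R) (p : nat -> R) : p @ \oo --> +oo ->
  (fun k => (p k - m) / (p k - 1)) @ \oo --> (1 : R).
Proof.
move=> poo.
have qoo : (fun k => p k - 1) @ \oo --> +oo.
  apply/cvgryPge => a; have := cvgry_ge poo (a + 1).
  by move=> H; near=> k; rewrite lerBrDr; near: k; exact: H.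
have cV : (fun k => (p k - 1)^-1) @ \oo --> (0 : R).
  exact: (iffRL (gtr0_cvgV0 (cvgry_gt qoo 0)) qoo).
have c : (fun k => 1 - (m - 1) * (p k - 1)^-1) @ \oo --> 1 - (m - 1) * 0.
  apply: cvgB; first exact: cvg_cst.
  by apply: cvgM cV; exact: cvg_cst.
rewrite mulr0 subr0 in c; apply: cvg_trans c; apply: near_eq_cvg.
have q0 : \forall k \near \oo, 0 < p k - 1 by exact: (cvgry_gt qoo 0).
by apply: filterS q0 => k q0; field; rewrite gt_eqF.
Unshelve. all: by end_near. Qed.

Lemma cvg_powR_exponent (c : nat -> R) (r : R) : 0 <= r ->
  c @ \oo --> (1 : R) -> (fun k => r `^ c k) @ \oo --> r.
Proof.
rewrite le_eqVlt => /predU1P[<-|r0] cc.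
  (* Zero to the power zero is 1, so the exponents must first be made positive. *)
  have c0 : \forall k \near \oo, 0 < c k by exact: (@cvgr_gt R _ _ _ _ _ cc 0 ltr01).
  have h0 : (fun _ : nat => 0 : R) @ \oo --> (0 : R) by exact: cvg_cst.
  apply: cvg_trans h0; apply: near_eq_cvg.
  by apply: filterS c0 => k ck; rewrite powR0// gt_eqF.
have -> : (fun k => r `^ c k) = (fun k => expR (c k * ln r)).
  by apply/funext => k; rewrite /powR gt_eqF.
move: (ln r) (lnK r0) => l lE.
have h : (fun k => c k * l) @ \oo --> 1 * l.
  by apply: cvgM cc _; exact: cvg_cst.
rewrite -lE -[X in _ --> expR X]mul1r.
exact: (@cvg_comp _ _ _ (fun k => c k * l) expR _ _ _ h (@continuous_expR R _)).
Qed.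

Lemma near_subsequence (s : nat -> nat) (Q : nat -> Prop) :
  (forall i j, (i < j)%N -> (s i < s j)%N) ->
  (\forall k \near \oo, Q k) -> \forall j \near \oo, Q (s j).
Proof.
move=> sinc [N _ NQ]; exists N => // j /= Nj; apply: NQ => /=.
apply: leq_trans Nj _; elim: j => // j IHj.
exact: leq_ltn_trans IHj (sinc _ _ (ltnSn j)).
Qed.

End Exponents.

(** * Passage to the limit *)

Lemma viscosity_gradient_subsolution {R : realType} {n : nat} (q M : R)
    (Omega : set 'rV[R]_n) (f u : 'rV[R]_n -> R) :
  (forall x, Omega x -> f x <= M) ->
  viscosity_subsolution q%:E Omega f u -> gradient_subsolution q Omega M u.
Proof.
move=> fM [_ sub] x phi Ox cphi mx g0.
by have [/(_ g0) s _] := sub x phi Ox cphi mx; apply: le_trans s (fM x Ox).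
Qed.

(** * Estimates uniform along the sequence *)

Section Sequence.
Context {R : realType} {n : nat} (n_ge2 : (2 <= n)%N).
Context {Omega : set 'rV[R]_n} (Omega_dom : bounded_domain Omega).
Context {p : nat -> R} (p_gtn : forall k, n%:R < p k) (p_oo : p @ \oo --> +oo).
Context {u_ f_ g_ : nat -> 'rV[R]_n -> R} {f g : 'rV[R]_n -> R}.
Hypothesis (u_sol : forall k, viscosity_dirichlet (p k)%:E Omega (f_ k) (g_ k) (u_ k)).
Hypothesis (f_bounded : exists M, forall x, Omega x -> `|f x| <= M).
Hypothesis (g_lip : holder (boundary Omega) 1 g).
Hypothesis (f_cvg : {uniform Omega, f_ @ \oo --> f}).
Hypothesis (g_cvg : {uniform boundary Omega, g_ @ \oo --> g}).

Let gamma k : R := (p k - n%:R) / (p k - 1).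

Lemma uniform_estimates : exists A C : R, 0 <= A /\
  (\forall k \near \oo, forall x, closure Omega x -> `|u_ k x| <= C) /\
  (forall e, 0 < e -> \forall k \near \oo, forall x y,
    closure Omega x -> closure Omega y ->
    u_ k x <= u_ k y + e + A * enorm (x - y) `^ gamma k).
Proof.
have [oO _ _ bO] := Omega_dom.
have n0 : (0 < n)%N by rewrite (leq_trans _ n_ge2).
have n2R : 2 <= n%:R :> R by rewrite ler_nat.
have [G [L [L0 gG gL]]] := holder_bounds g_lip.
have [M' fM'] := f_bounded.
have [D [y0 [D1 nOy0 dD dy0]]] := diameter_and_pole n0 bO.
(* The bound on [f] controls all late [f_ k]; the added 1 absorbs their distance to [f]. *)
pose M := `|M'| + 1; have M0 : 0 <= M by rewrite addr_ge0.
pose A := L * D + 2 * (M + 1) * D ^+ 2 + 1.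
have D0 : 0 <= D by rewrite (le_trans _ D1).
have A0 : 0 <= A by rewrite !addr_ge0// ?mulr_ge0 ?exprn_ge0 ?addr_ge0.
(* Half of [gamma k], the barriers being written in the squared distance. *)
pose b k := (p k - n%:R) / (2 * (p k - 1)).
have gammaE k : 2 * b k = gamma k.
  have q1 : 0 < p k - 1 by have := p_gtn k; lra.
  by rewrite /b /gamma; field; rewrite gt_eqF.
have b4 : \forall k \near \oo, 4^-1 <= b k.
  have H : \forall k \near \oo, 2^-1 < gamma k.
    apply: (@cvgr_gt R _ _ _ _ _ (cvg_exponent n%:R p_oo)).
    by rewrite invf_lt1// ltr1n.
  by apply: filterS H => k; rewrite -gammaE; lra.
have fM : \forall k \near \oo, forall x, Omega x -> `|f_ k x| <= M.
  have := (uniform_cvg_dist _ _ _).1 f_cvg 1 ltr01.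
  apply: filterS => k fk x Ox; have := fk x Ox; have := fM' x Ox.
  have := ler_norm M'; rewrite /M !ler_norml => ? /andP[? ?] /andP[? ?].
  by apply/andP; split; lra.
have subs : \forall k \near \oo, gradient_subsolution (p k) Omega M (u_ k) /\
    gradient_subsolution (p k) Omega M (- u_ k).
  apply: filterS fM => k fk; have [[sub super] _ _] := u_sol k; split.
    apply: viscosity_gradient_subsolution sub => x Ox.
    by have := fk x Ox; rewrite ler_norml => /andP[].
  apply: viscosity_gradient_subsolution (viscosity_subsolutionN oO super) => x Ox.
  by have := fk x Ox; rewrite ler_norml => /andP[h _]; rewrite lerNl.
have cu k : {within closure Omega, continuous (u_ k)} by have [] := u_sol k.
have cuN k : {within closure Omega, continuous (- u_ k)}.
  by move=> x; apply: continuousN; exact: cu.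
have ug e : 0 < e -> \forall k \near \oo, forall x, boundary Omega x ->
    `|u_ k x - g x| <= e.
  move=> e0; have := (uniform_cvg_dist _ _ _).1 g_cvg e e0.
  apply: filterS => k gk x bx; have [_ _ ->//] := u_sol k.
  exact: gk.
exists A, (G + 1 + A * D); split=> //; split.
  apply: filterS (filterI b4 (filterI subs (ug 1 ltr01))) => k [bk [[s1 s2] ugk]] x Kx.
  rewrite ler_norml; apply/andP; split.
    rewrite lerNl; have H1 z : boundary Omega z -> (- u_ k) z <= (- g) z + 1.
      move=> bz; have := ugk z bz; rewrite ler_norml => /andP[h _].
      by change (- u_ k z <= - g z + 1); lra.
    have H2 z : boundary Omega z -> (- g) z <= G.
      move=> bz; have := gG z bz; rewrite ler_norml => /andP[h _].
      by change (- g z <= G); lra.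
    exact: (sup_estimate n_ge2 (p_gtn k) oO bO erefl bk M0 L0 D1 s2 (cuN k) nOy0
      dy0 H1 H2 Kx).
  have H1 z : boundary Omega z -> u_ k z <= g z + 1.
    by move=> bz; have := ugk z bz; rewrite ler_norml => /andP[_]; lra.
  have H2 z : boundary Omega z -> g z <= G.
    by move=> bz; have := gG z bz; rewrite ler_norml => /andP[].
  exact: (sup_estimate n_ge2 (p_gtn k) oO bO erefl bk M0 L0 D1 s1 (cu k) nOy0
    dy0 H1 H2 Kx).
move=> e e0; have e2 : 0 < e / 2 by rewrite divr_gt0.
apply: filterS (filterI b4 (filterI subs (ug _ e2))) => k [bk [[s1 s2] ugk]] x y Kx Ky.
rewrite -gammaE.
have := global_estimate n_ge2 (p_gtn k) oO bO erefl bk M0 (ltW e2) L0 D1 dD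
  s1 s2 (cu k) ugk gL Kx Ky.
by rewrite (_ : 2 * (e / 2) = e)//; field.
Qed.

(** Within distance 1, every power with exponent at least 1/2 lies below the square root of the
    distance, so one modulus serves all large k. In the squared distance the square root is the
    power [4^-1]. *)
Lemma asymptotic_equicontinuity (A : R) (b : nat -> R) (K : set 'rV[R]_n) :
  0 <= A -> (\forall k \near \oo, 2^-1 <= b k) ->
  (forall e, 0 < e -> \forall k \near \oo, forall x y, K x -> K y ->
    u_ k x <= u_ k y + e + A * enorm (x - y) `^ b k) ->
  forall eps, 0 < eps -> forall x, K x ->
    \forall y \near x & k \near \oo, K y -> `|u_ k y - u_ k x| <= eps.
Proof.
move=> A0 b2 est eps eps0 x Kx.
have e2 : 0 < eps / 2 by rewrite divr_gt0.
have Q1 : \forall y \near x, dot (y - x) (y - x) < 1.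
  have h : dot (x - x) (x - x) < 1 by rewrite subrr dot0l.
  exact: (@cvgr_lt R _ _ _ _ _ (@dotB_continuous R n x x) _ h).
have Q2 : \forall y \near x, A * dot (y - x) (y - x) `^ 4^-1 < eps / 2.
  have c : {for x, continuous (fun y : 'rV[R]_n => A * dot (y - x) (y - x) `^ 4^-1)}.
    apply: continuousM; first exact: cst_continuous.
    by apply: powR_sqdist_continuous; rewrite invr_gt0.
  have h : A * dot (x - x) (x - x) `^ 4^-1 < eps / 2.
    by rewrite subrr dot0l powR0 ?invr_neq0// mulr0.
  exact: (@cvgr_lt R _ _ _ _ _ c _ h).
exists ([set y | dot (y - x) (y - x) < 1 /\ A * dot (y - x) (y - x) `^ 4^-1 < eps / 2],
  [set k | 2^-1 <= b k /\ forall x y, K x -> K y ->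
    u_ k x <= u_ k y + eps / 2 + A * enorm (x - y) `^ b k]).
  by split; [exact: (filterI Q1 Q2)|exact: (filterI b2 (est _ e2))].
move=> [y k] [/= [d1 dA] [bk estk]] Ky.
have H : A * enorm (y - x) `^ b k <= eps / 2.
  apply: le_trans (ltW dA); apply: ler_wpM2l => //.
  have [->|yx] := eqVneq y x.
    by rewrite subrr enorm0 dot0l !powR0 ?invr_neq0// gt_eqF// (lt_le_trans _ bk).
  rewrite -sqr_enorm in d1 *; rewrite powR_sqr ?enorm_ge0//.
  apply: ger_powR; last by apply: le_trans bk; rewrite lter_pdivrMr//; lra.
  rewrite enorm_gt0 subr_eq0 yx /= -(@ler_pXn2r _ 2) ?nnegrE ?enorm_ge0//.
  by rewrite expr1n ltW.
have h1 := estk y x Ky Kx; have h2 := estk x y Kx Ky.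
rewrite (enormB x) in h2.
by rewrite ler_norml; apply/andP; split; lra.
Qed.

End Sequence.

Theorem theorem6p1 (R : realType) (n : nat) (n_ge2 : (2 <= n)%N)
    (Omega : set 'rV[R]_n) (Omega_dom : bounded_domain Omega)
    (p : nat -> R) (p_gtn : forall k, n%:R < p k) (p_oo : p @ \oo --> +oo)
    (u_ f_ g_ : nat -> 'rV[R]_n -> R)
    (f_cont : forall k, {within Omega, continuous (f_ k)})
    (g_holder : forall k,
       holder (boundary Omega) ((p k - n%:R) / (p k - 1)) (g_ k))
    (u_sol : forall k, viscosity_dirichlet (p k)%:E Omega (f_ k) (g_ k) (u_ k))
    (f g : 'rV[R]_n -> R)
    (f_lim_cont : {within Omega, continuous f})
    (f_lim_bounded : exists M, forall x, Omega x -> `|f x| <= M)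
    (g_lim_lip : holder (boundary Omega) 1 g)
    (f_cvg : {uniform Omega, f_ @ \oo --> f})
    (g_cvg : {uniform boundary Omega, g_ @ \oo --> g}) :
  exists (s : nat -> nat) (u : 'rV[R]_n -> R),
    [/\ forall i j, (i < j)%N -> (s i < s j)%N,
        {uniform closure Omega, (u_ \o s) @ \oo --> u},
        viscosity_dirichlet +oo%E Omega f g u
      & holder Omega 1 u].
Proof.
have [oO _ _ bO] := Omega_dom.
have n0 : (0 < n)%N by rewrite (leq_trans _ n_ge2).
have [A [C [A0 [uC est]]]] := uniform_estimates n_ge2 Omega_dom p_gtn p_oo u_sol
  f_lim_bounded g_lim_lip f_cvg g_cvg.
have gamma1 := cvg_exponent n%:R p_oo.
have gamma2 : \forall k \near \oo, 2^-1 <= (p k - n%:R) / (p k - 1).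
  have h : 2^-1 < 1 :> R by rewrite invf_lt1// ltr1n.
  exact: (@cvgr_ge R _ _ _ _ _ gamma1 _ h).
have [s [u [s_inc su]]] := arzela_ascoli_subsequence (compact_closure bO) uC
  (asymptotic_equicontinuity A0 gamma2 est).
have u_cvg : {uniform closure Omega, (u_ \o s) @ \oo --> u}.
  exact/uniform_cvg_dist.
have cu_ k : {within closure Omega, continuous (u_ k)} by have [] := u_sol k.
have cu : {within closure Omega, continuous u}.
  apply: uniform_limit_continuous_subspace u_cvg.
  by exists 0%N => // k _; exact: cu_.
have sub_cvg (F : nat -> 'rV[R]_n -> R) (h : 'rV[R]_n -> R) (B : set 'rV[R]_n) :
    {uniform B, F @ \oo --> h} -> forall eps, 0 < eps ->
    \forall j \near \oo, forall x, B x -> `|F (s j) x - h x| <= eps.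
  by move=> /uniform_cvg_dist Fh eps eps0; exact: near_subsequence s_inc (Fh eps eps0).
have u_lip x y : closure Omega x -> closure Omega y ->
    u x <= u y + A * enorm (x - y).
  move=> Kx Ky; apply/ler_addgt0Pr => e e0.
  (* Four errors of e / 4: uniform convergence at [x] and at [y], the error in the estimate, and the
     replacement of the exponent by 1. *)
  have e4 : 0 < e / 4 by rewrite divr_gt0.
  have cr : (fun k => A * enorm (x - y) `^ ((p k - n%:R) / (p k - 1))) @ \oo -->
      A * enorm (x - y).
    apply: cvgM; first exact: cvg_cst.
    exact: cvg_powR_exponent (enorm_ge0 _) gamma1.
  have lr : A * enorm (x - y) < A * enorm (x - y) + e / 4 by rewrite ltrDl.
  have near_r : \forall k \near \oo,
      A * enorm (x - y) `^ ((p k - n%:R) / (p k - 1)) < A * enorm (x - y) + e / 4.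
    exact: (@cvgr_lt R _ _ _ _ _ cr _ lr).
  have [j [h1 [h2 h3]]] := @filter_ex _ \oo _ _
    (filterI (near_subsequence s_inc near_r)
      (filterI (near_subsequence s_inc (est _ e4)) (su _ e4))).
  have := h2 x y Kx Ky; have := h3 x Kx; have := h3 y Ky.
  rewrite !ler_norml => /andP[a1 a2] /andP[b1 b2] c1; lra.
have u_bdd x : closure Omega x -> `|u x| <= C + 1.
  move=> Kx.
  have [j [h1 h2]] := @filter_ex _ \oo _ _
    (filterI (near_subsequence s_inc uC) (su 1 ltr01)).
  have := h1 x Kx; have := h2 x Kx.
  rewrite !ler_norml => /andP[a1 a2] /andP[b1 b2]; apply/andP; split; lra.
have KO : Omega `<=` closure Omega := @subset_closure _ Omega.
have cuO : {within Omega, continuous u} := continuous_subspaceW KO cu.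
have cu_O k : {within Omega, continuous (u_ k)} := continuous_subspaceW KO (cu_ k).
have ps_oo : (p \o s) @ \oo --> +oo.
  apply/cvgryPge => a; exact: near_subsequence s_inc (cvgry_ge p_oo a).
have su_O eps : 0 < eps -> \forall j \near \oo, forall x, Omega x ->
    `|u_ (s j) x - u x| <= eps.
  by move=> /su; apply: filterS => j uj x /KO; exact: uj.
exists s, u; split=> //; last first.
  by apply: (@lipschitz_holder R n Omega (C + 1) A) => [x /KO|x y /KO Kx /KO];
    [exact: u_bdd|exact: u_lip].
split=> //; last first.
  move=> x bx; apply/eqP; rewrite -subr_eq0 -normr_le0; apply/ler_addgt0Pr => e e0.
  have e2 : 0 < e / 2 by rewrite divr_gt0.
  have Kx : closure Omega x by case: bx.
  have [j [h1 h2]] := @filter_ex _ \oo _ _ (filterI (su _ e2) (sub_cvg _ _ _ g_cvg _ e2)).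
  have := h1 x Kx; have := h2 x bx; have [_ _ ->//] := u_sol (s j).
  rewrite !ler_norml => /andP[a1 a2] /andP[b1 b2]; apply/andP; split; lra.
split.
  apply: (@stability_subsolution R n Omega (u_ \o s) u oO (fun k => cu_O (s k)) su_O
    (p \o s) (f_ \o s) f n0 ps_oo (sub_cvg _ _ _ f_cvg) f_lim_cont cuO) => k.
  by have [[]] := u_sol (s k).
rewrite -(opprK f) -(opprK u); apply: viscosity_supersolutionN => //.
apply: (@stability_subsolution R n Omega (fun k => - u_ (s k)) (- u) oO _ _
    (p \o s) (fun k => - f_ (s k)) (- f) n0 ps_oo _ _ _) => [k|e e0|e e0|||k].
- by move=> x; apply: continuousN; exact: cu_O.
- apply: filterS (su_O e e0) => j uj x Ox.
  by change (`|- u_ (s j) x - - u x| <= e); rewrite -opprD normrN; exact: uj.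
- apply: filterS (sub_cvg _ _ _ f_cvg e e0) => j uj x Ox.
  by change (`|- f_ (s j) x - - f x| <= e); rewrite -opprD normrN; exact: uj.
- by move=> x; apply: continuousN; exact: f_lim_cont.
- by move=> x; apply: continuousN; exact: cuO.
- by apply: viscosity_subsolutionN => //; have [[]] := u_sol (s k).
Qed.
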